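(* Let $E$ be a finite directed graph with no sinks, such that no two (distinct) edges share the same source and range, and let $\mathbb{Z}/2$ act on $C^*(E)$ via restriction of the gauge action. If the vector $\begin{pmatrix}1&1&\cdots&1\end{pmatrix}$ is a nonnegative linear combination of rows of $I+A_E$, where $A_E$ is the adjacency matrix of $E$, then $$\mathrm{dim}^{\mathbb{Z}/2}_{\mathrm{LT}}(C^*(E))\le2\,|E^0|-1.$$
   Context: A directed graph is $E=(E^0,E^1,r,s)$ with vertex set $E^0$, edge set $E^1$, and range and source maps $r,s:E^1\to E^0$; finite means $E^0$ and $E^1$ are finite; loops are allowed. A sink is a vertex emitting no edges. The adjacency matrix is $(A_E)_{vw}=$ number of edges with source $v$ and range $w$. $C^*(E)$ is the universal $C^*$-algebra generated by mutually orthogonal projections $P_v$ ($v\in E^0$) and partial isometries $S_e$ ($e\in E^1$) with mutually orthogonal ranges such that $S_e^*S_e=P_{r(e)}$, $S_eS_e^*\le P_{s(e)}$, and $P_v=\sum_{e\in s^{-1}(v)}S_eS_e^*$ whenever $s^{-1}(v)$ is nonempty and finite. The gauge action of $\mathbb{S}^1$ is $S_e\mapsto\lambda S_e$, $P_v\mapsto P_v$ for $\lambda\in\mathbb{S}^1$; its restriction to $\mathbb{Z}/2=\{\pm1\}$ is generated by $S_e\mapsto-S_e$, $P_v\mapsto P_v$. Local-triviality dimension: let a compact group $G$ act on a unital $C^*$-algebra $A$. Equip $C(G)$ with $(\alpha_gf)(h)=f(hg)$ and $C_0((0,1])\otimes C(G)$ with the action on the second factor, and let $t$ be the identity function in $C_0((0,1])$.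 $\mathrm{dim}^G_{\mathrm{LT}}(A)$ is the smallest $n\ge0$ for which there exist $G$-equivariant $*$-homomorphisms $\rho_0,\ldots,\rho_n:C_0((0,1])\otimes C(G)\to A$ with $\sum_{i=0}^n\rho_i(t\otimes1)=1$ ($\infty$ if no such $n$ exists). *)

(* Defs.v *)
From HB Require Import structures.
From mathcomp Require Import all_boot all_order all_algebra.
From mathcomp Require Import complex.
From mathcomp Require Import all_classical all_reals all_analysis.
Import numFieldNormedType.Exports.

Set Implicit Arguments.
Unset Strict Implicit.
Unset Printing Implicit Defensive.

Import Order.TTheory GRing.Theory Num.Theory.
Local Open Scope classical_set_scope.
Local Open Scope ring_scope.

(* Naming R[i] at a structure type lets the generic topology and norm of a
   numFieldType apply to it. *)
Definition Cx (R : realType) : numClosedFieldType := R[i].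
Definition ofR (R : realType) (x : R) : Cx R := x%:C%C.

(* Not MathComp rings, which always carry a unit: the algebras
   here need not be unital, and homomorphisms need not preserve units. *)
HB.mixin Record isStarAlg (R : realType) A of GRing.Lmodule (Cx R) A := {
  amul : A -> A -> A;
  star : A -> A;
  amulA : associative amul;
  amulDl : forall x y z : A, amul (x + y) z = amul x z + amul y z;
  amulDr : forall x y z : A, amul x (y + z) = amul x y + amul x z;
  amulZl : forall (c : Cx R) (x y : A), amul (c *: x) y = c *: amul x y;
  amulZr : forall (c : Cx R) (x y : A), amul x (c *: y) = c *: amul x y;
  starK : involutive star;
  starD : forall x y : A, star (x + y) = star x + star y;
  starZ : forall (c : Cx R) (x : A), star (c *: x) = c^* *: star x;
  starM : forall x y : A, star (amul x y) = amul (star y) (star x)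
}.

#[short(type="starAlgType")]
HB.structure Definition StarAlg (R : realType) :=
  {A of GRing.Lmodule (Cx R) A & isStarAlg R A}.

HB.mixin Record isCStarAlg (R : realType) A
    of CompleteNormedModule (Cx R) A & StarAlg R A := {
  norm_amul : forall x y : A, `|amul x y| <= `|x| * `|y| ;
  norm_star_amul : forall x : A, `|amul (star x) x| = `|x| ^+ 2
}.

#[short(type="cstarAlgType")]
HB.structure Definition CStarAlg (R : realType) :=
  {A of CompleteNormedModule (Cx R) A & StarAlg R A & isCStarAlg R A}.

(* Homomorphisms between C*-algebras are purely algebraic; continuity is automatic. *)
Definition star_hom (R : realType) (A B : starAlgType R) (f : A -> B) : Prop :=
  [/\ linear f,
      forall x y : A, f (amul x y) = amul (f x) (f y)
    & forall x : A, f (star x) = star (f x)].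

Definition is_one (R : realType) (A : starAlgType R) (u : A) : Prop :=
  forall x : A, amul u x = x /\ amul x u = x.

(* x <= y iff y - x is positive, i.e. of the form b^* b. *)
Definition star_le (R : realType) (A : starAlgType R) (x y : A) : Prop :=
  exists b : A, y - x = amul (star b) b.

Definition is_proj (R : realType) (A : starAlgType R) (p : A) : Prop :=
  amul p p = p /\ star p = p.

Definition is_pisom (R : realType) (A : starAlgType R) (s : A) : Prop :=
  amul (amul s (star s)) s = s.

Definition C0_set (R : realType) (X : topologicalType) : set (X -> Cx R) :=
  [set f | continuous f /\
    forall eps : Cx R, 0 < eps ->
      exists2 K : set X, compact K & forall x, ~ K x -> `|f x| < eps].
Arguments C0_set : clear implicits.

Section C0.
Variables (R : realType) (X : topologicalType).

Definition C0_pred : {pred (X -> Cx R)} := mem (C0_set R X).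

Fact C0_predP (f : X -> Cx R) : f \in C0_pred <-> C0_set R X f.
Proof. by split => [/set_mem|/mem_set]. Qed.

Fact C0_submod : submod_closed C0_pred.
Proof.
split.
  apply/C0_predP; split; first exact: cst_continuous.
  by move=> e e0; exists set0; [exact: compact0|move=> x _; rewrite normr0].
move=> a f g /C0_predP[fc f0] /C0_predP[gc g0]; apply/C0_predP; split.
  by move=> x; apply: cvgD; [apply: cvgZr; exact: fc|exact: gc].
move=> e e0; have a0 : 0 < `|a| + 1 by rewrite ltr_wpDl.
have [|K cK fK] := f0 (e / 2 / (`|a| + 1)); first by rewrite !divr_gt0.
have [|L cL gL] := g0 (e / 2); first by rewrite divr_gt0.
exists (K `|` L); first exact: compactU.
move=> x /not_orP[/fK fx /gL gx].
apply: (le_lt_trans (ler_normD _ _)); rewrite (splitr e).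
apply: ltr_leD => //; last exact: ltW.
rewrite normrZ; apply: (@le_lt_trans _ _ ((`|a| + 1) * `|f x|)).
  by rewrite ler_wpM2r // lerDl.
by rewrite mulrC -ltr_pdivlMr.
Qed.

Fact C0_mul (f g : X -> Cx R) : C0_set R X f -> C0_set R X g ->
  C0_set R X (fun x => f x * g x).
Proof.
move=> [fc f0] [gc g0]; split.
  by move=> x; apply: cvgM; [exact: fc|exact: gc].
move=> e e0; have [K cK fK] := f0 _ e0.
have [L cL gL] := g0 1 ltr01.
exists (K `|` L); first exact: compactU.
move=> x /not_orP[/fK fx /gL gx]; rewrite normrM -[ltRHS]mulr1.
exact: ltr_pM.
Qed.

Fact C0_conj (f : X -> Cx R) : C0_set R X f -> C0_set R X (fun x => (f x)^*).
Proof.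
move=> [fc f0]; split.
  move=> x; apply/cvgrPdist_lt => e e0.
  have /cvgrPdist_lt/(_ e e0) := fc x.
  by apply: filterS => y; rewrite -rmorphB norm_conjC.
move=> e /f0[K cK fK]; exists K => // x /fK.
by rewrite norm_conjC.
Qed.

HB.instance Definition _ :=
  GRing.isSubmodClosed.Build (Cx R) (X -> Cx R) C0_pred C0_submod.

Definition C0 : Type := {f : X -> Cx R | f \in C0_pred}.

HB.instance Definition _ := SubChoice.on C0.
HB.instance Definition _ := [SubChoice_isSubLmodule of C0 by <:].

Definition mkC0 (f : X -> Cx R) (fP : C0_set R X f) : C0 := exist _ f (mem_set fP).

Definition C0_fun (f : C0) : X -> Cx R := val f.
Coercion C0_fun : C0 >-> Funclass.

Fact C0P (f : C0) : C0_set R X f.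
Proof. exact/C0_predP/valP. Qed.

Fact C0_ext (f g : C0) : f =1 g -> f = g.
Proof. by move=> fg; apply/val_inj/funext. Qed.

Definition C0_amul (f g : C0) : C0 := mkC0 (C0_mul (C0P f) (C0P g)).
Definition C0_star (f : C0) : C0 := mkC0 (C0_conj (C0P f)).

Fact C0_amulA : associative C0_amul.
Proof. by move=> f g h; apply: C0_ext => x; exact: mulrA. Qed.
Fact C0_amulDl (f g h : C0) : C0_amul (f + g) h = C0_amul f h + C0_amul g h.
Proof. by apply: C0_ext => x; exact: mulrDl. Qed.
Fact C0_amulDr (f g h : C0) : C0_amul f (g + h) = C0_amul f g + C0_amul f h.
Proof. by apply: C0_ext => x; exact: mulrDr. Qed.
Fact C0_amulZl (c : Cx R) (f g : C0) : C0_amul (c *: f) g = c *: C0_amul f g.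
Proof. by apply: C0_ext => x; exact/esym/mulrA. Qed.
Fact C0_amulZr (c : Cx R) (f g : C0) : C0_amul f (c *: g) = c *: C0_amul f g.
Proof. by apply: C0_ext => x; exact: mulrCA. Qed.
Fact C0_starK : involutive C0_star.
Proof. by move=> f; apply: C0_ext => x; exact: conjCK. Qed.
Fact C0_starD (f g : C0) : C0_star (f + g) = C0_star f + C0_star g.
Proof. by apply: C0_ext => x; exact: rmorphD. Qed.
Fact C0_starZ (c : Cx R) (f : C0) : C0_star (c *: f) = c^* *: C0_star f.
Proof. by apply: C0_ext => x; exact: rmorphM. Qed.
Fact C0_starM (f g : C0) : C0_star (C0_amul f g) = C0_amul (C0_star g) (C0_star f).
Proof. by apply: C0_ext => x; rewrite [LHS]rmorphM; exact: mulrC. Qed.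

HB.instance Definition _ := @isStarAlg.Build R C0 C0_amul C0_star
  C0_amulA C0_amulDl C0_amulDr C0_amulZl C0_amulZr
  C0_starK C0_starD C0_starZ C0_starM.

End C0.

Local Open Scope group_scope.
HB.mixin Record isCompactGroup G of Group G & Topological G := {
  cgroup_mul_continuous : continuous (fun gh : G * G => gh.1 * gh.2 : G);
  cgroup_inv_continuous : continuous (fun g : G => g^-1 : G);
  cgroup_compact : compact [set: G];
  cgroup_hausdorff : hausdorff_space G
}.

#[short(type="compactGroupType")]
HB.structure Definition CompactGroup :=
  {G of Group G & Topological G & isCompactGroup G}.

Record is_action (R : realType) (G : compactGroupType) (A : cstarAlgType R)
    (alpha : G -> A -> A) : Prop := IsAction {
  action_hom : forall g, star_hom (alpha g);
  action1 : forall a, alpha 1 a = a;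
  actionM : forall g h a, alpha (g * h) a = alpha g (alpha h a);
  action_continuous : forall a, continuous (alpha^~ a)
}.

(* Z/2 = {1, -1}, the boolean b standing for the complex number (-1) ^+ b. *)
Definition Z2 : Type := bool.
HB.instance Definition _ := Topological.copy Z2 bool.
HB.instance Definition _ := @isGroup.Build Z2 false id addb
  addbA addFb addbF addbb addbb.

Fact Z2_mul_continuous : continuous (fun gh : Z2 * Z2 => gh.1 * gh.2 : Z2).
Proof.
move=> [g h] U /principal_filterP gU.
exists ([set g], [set h]); first by split; exact/principal_filterP.
by move=> [a b] [/= -> ->].
Qed.

Fact Z2_inv_continuous : continuous (fun g : Z2 => g^-1 : Z2).
Proof. by move=> g; exact: cvg_id. Qed.

Fact Z2_hausdorff : hausdorff_space Z2.
Proof. exact: discrete_hausdorff. Qed.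

HB.instance Definition _ := @isCompactGroup.Build Z2
  Z2_mul_continuous Z2_inv_continuous bool_compact Z2_hausdorff.

Local Close Scope group_scope.

Definition Ioc01 (R : realType) : Type := set_type (`]0, 1]%classic : set R).
HB.instance Definition _ (R : realType) := Topological.on (Ioc01 R).
Definition Ioc01_val (R : realType) (s : Ioc01 R) : R := set_val s.

(* C_0((0,1]) (x) C(G), in the form C_0((0,1] * G): C_0(X) (x) C_0(Y) is
   C_0(X * Y), with (f (x) g)(x, y) = f x * g y. *)
Notation cone R G := (C0 R (Ioc01 R * G)%type).

Section Cone.
Variables (R : realType) (G : compactGroupType).

Fact ofR_continuous : continuous (@ofR R : R -> Cx R).
Proof.
move=> x; apply/cvgrPdist_lt => e e0.
have er : e = ofR (complex.Re e).
  by have /ger0_Im/eqP := ltW e0; case: e {e0} => a b /= /eqP ->.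
have r0 : 0 < complex.Re e by move: e0; rewrite er (ltcR 0).
near=> y; rewrite er /ofR -rmorphB normc_def /= expr0n addr0 sqrtr_sqr.
rewrite ltcR; near: y; exact: (@cvgr_dist_lt _ _ _ _ _ id x cvg_id).
Unshelve. all: by end_near. Qed.

Fact Ioc01_val_continuous : continuous (@Ioc01_val R).
Proof. exact: initial_continuous. Qed.

Fact Ioc01_ge_compact (e : R) : 0 < e ->
  compact [set s : Ioc01 R | e <= Ioc01_val s].
Proof.
move=> e0; case: (leP e 1) => [e1|e1]; last first.
  rewrite (_ : mkset _ = set0); first exact: compact0.
  apply/seteqP; split => // s /= es.
  have := set_valP s; rewrite /= in_itv /= => /andP[_].
  by rewrite leNgt (lt_le_trans e1 es).
have clampP (x : R) : Num.max e (Num.min x 1) \in (`]0, 1]%classic : set R).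
  by apply/mem_set; rewrite /= in_itv /= lt_max e0 ge_max e1 ge_min lexx orbT.
pose clamp (x : R) : Ioc01 R := exist (fun y : R => y \in `]0, 1]%classic) _ (clampP x).
have clamp_continuous : continuous clamp.
  apply: continuous_comp_initial => x.
  have cmin : {for x, continuous (fun y : R => Num.min y 1)}.
    apply: (@continuous_min _ _ id (fun=> 1)); first exact: cvg_id.
    exact: cvg_cst.
  apply: (@continuous_max R R (fun=> e) (fun y => Num.min y 1) x) => //.
  exact: cvg_cst.
have -> : [set s : Ioc01 R | e <= Ioc01_val s] = clamp @` `[e, 1]; last first.
  apply: continuous_compact; last exact: segment_compact.
  exact: continuous_subspaceT.
apply/seteqP; split => [s /= es|s [x /=]].
  have := set_valP s; rewrite /= in_itv /= => /andP[_ s1].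
  exists (Ioc01_val s); first by rewrite in_itv /= es.
  by apply/val_inj; rewrite /= min_l // max_r.
by rewrite in_itv /= => /andP[ex x1] <-; rewrite /Ioc01_val set_valE /= min_l // max_r.
Qed.

Fact cone_t1_subproof : C0_set R (Ioc01 R * G)%type
  (fun p => ofR (Ioc01_val p.1)).
Proof.
split.
  move=> p; apply: continuous_comp; last exact: ofR_continuous.
  by apply: continuous_comp; [exact: cvg_fst|exact: Ioc01_val_continuous].
move=> e e0.
have er : e = ofR (complex.Re e).
  by have /ger0_Im/eqP := ltW e0; case: e {e0} => a b /= /eqP ->.
have r0 : 0 < complex.Re e by move: e0; rewrite er (ltcR 0).
exists ([set s : Ioc01 R | complex.Re e <= Ioc01_val s] `*` [set: G]).
  by apply: compact_setX; [exact: Ioc01_ge_compact|exact: cgroup_compact].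
move=> [s g] /= /not_andP[|//] /negP; rewrite -ltNge => se.
have s0 : 0 <= Ioc01_val s.
  by have := set_valP s; rewrite /= in_itv /= => /andP[/ltW].
by rewrite er /ofR ger0_norm ?ltcR ?(lecR 0).
Qed.

(* t (x) 1, for t the identity function of (0, 1] *)
Definition cone_t1 : cone R G := mkC0 cone_t1_subproof.

Fact cone_act_subproof (g : G) (f : cone R G) :
  C0_set R (Ioc01 R * G)%type (fun p => f (p.1, (p.2 * g)%g)).
Proof.
have [fc f0] := C0P f.
have tr_continuous (h : G) :
    continuous (fun p : Ioc01 R * G => (p.1, (p.2 * h)%g) : Ioc01 R * G).
  move=> p.
  have ph : (fun q : Ioc01 R * G => (q.2, h)) @ p --> (p.2, h).
    by apply: (@cvg_pair _ _ _ (nbhs p) (nbhs p.2) (nbhs h));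
      [exact: cvg_snd|exact: cvg_cst].
  apply: (@cvg_pair _ _ _ (nbhs p) (nbhs p.1) (nbhs (p.2 * h)%g)).
    exact: cvg_fst.
  exact: (cvg_comp _ _ ph (@cgroup_mul_continuous G (p.2, h))).
split.
  by move=> p; apply: (@continuous_comp _ _ _ _ (C0_fun f) p);
    [exact: tr_continuous|exact: fc].
move=> e /f0[K cK fK].
exists ((fun p : Ioc01 R * G => (p.1, (p.2 * g^-1)%g) : Ioc01 R * G) @` K).
  apply: continuous_compact => //; apply: continuous_subspaceT.
  exact: tr_continuous.
move=> [s h] /= sh; apply: fK => Ksh; apply: sh.
by exists (s, (h * g)%g) => //=; rewrite mulgK.
Qed.

Definition cone_act (g : G) (f : cone R G) : cone R G :=
  mkC0 (cone_act_subproof g f).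

End Cone.

Definition equivariant (T U V : Type) (a : T -> U -> U) (b : T -> V -> V)
    (f : U -> V) : Prop :=
  forall g u, f (a g u) = b g (f u).

(* The algebra A is not assumed unital: that the sum is its identity is part of
   the condition. *)
Definition LT_cover (R : realType) (G : compactGroupType) (A : cstarAlgType R)
    (alpha : G -> A -> A) (n : nat) : Prop :=
  exists rho : 'I_n.+1 -> cone R G -> A,
    [/\ forall i, star_hom (rho i),
        forall i, equivariant (@cone_act R G) alpha (rho i)
      & is_one (\sum_(i < n.+1) rho i (cone_t1 R G))].

(* The least such n, and +oo if there is none: an infimum of natural numbers is
   attained, and ereal_inf set0 = +oo. *)
Definition dimLT (R : realType) (G : compactGroupType) (A : cstarAlgType R)
    (alpha : G -> A -> A) : \bar R :=
  ereal_inf [set n%:R%:E | n in [set n | LT_cover alpha n]].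

Record digraph := Digraph {
  vert : finType;
  edge : finType;
  src : edge -> vert;
  rng : edge -> vert
}.

Definition is_sink (E : digraph) (v : vert E) : Prop :=
  forall e : edge E, src e != v.

Definition adjacency (R : realType) (E : digraph) : 'M[R]_#|vert E| :=
  \matrix_(i, j) #|[pred e : edge E | (src e == enum_val i)
                                   && (rng e == enum_val j)]|%:R.

Record CK_family (R : realType) (E : digraph) (B : cstarAlgType R)
    (P : vert E -> B) (S : edge E -> B) : Prop := CKFamily {
  CK_proj : forall v, is_proj (P v);
  CK_proj_orth : forall v w, v != w -> amul (P v) (P w) = 0;
  CK_pisom : forall e, is_pisom (S e);
  CK_range_orth : forall e f, e != f ->
    amul (amul (S e) (star (S e))) (amul (S f) (star (S f))) = 0;
  CK_source : forall e, amul (star (S e)) (S e) = P (rng e);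
  CK_range_le : forall e, star_le (amul (S e) (star (S e))) (P (src e));
  CK_sum : forall v, (exists e, src e = v) ->
    P v = \sum_(e | src e == v) amul (S e) (star (S e))
}.

Definition star_subalg (R : realType) (A : starAlgType R) (D : set A) : Prop :=
  [/\ D 0,
      forall (c : Cx R) (x y : A), D x -> D y -> D (c *: x + y),
      forall x y : A, D x -> D y -> D (amul x y)
    & forall x : A, D x -> D (star x)].

(* (A, P, S) is the universal C*-algebra generated by a Cuntz-Krieger
   E-family, i.e. A is C*(E) with its canonical generators. The
   homomorphism phi is unique because P and S generate A. *)
Record is_graph_cstar (R : realType) (E : digraph) (A : cstarAlgType R)
    (P : vert E -> A) (S : edge E -> A) : Prop := IsGraphCstar {
  graph_cstar_CK : CK_family P S;
  graph_cstar_generated : forall D : set A, closed D -> star_subalg D ->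
    (forall v, D (P v)) -> (forall e, D (S e)) -> D = setT;
  graph_cstar_universal : forall (B : cstarAlgType R)
    (Q : vert E -> B) (T : edge E -> B), CK_family Q T ->
    exists phi : A -> B, [/\ star_hom phi,
      forall v, phi (P v) = Q v & forall e, phi (S e) = T e]
}.

Definition is_Z2_gauge (R : realType) (E : digraph) (A : cstarAlgType R)
    (P : vert E -> A) (S : edge E -> A) (alpha : Z2 -> A -> A) : Prop :=
  [/\ is_action alpha,
      forall g v, alpha g (P v) = P v
    & forall (g : Z2) e, alpha g (S e) = ((-1) ^+ (g : bool) : Cx R) *: S e].

(* Main.v *)
Require Import Defs.
From HB Require Import structures.
From mathcomp Require Import all_boot all_order all_algebra.
From mathcomp Require Import complex.
From mathcomp Require cyclotomic separable cyclic.
From mathcomp Require Import zify ring lra.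
From mathcomp Require Import all_classical all_reals all_analysis.
Import numFieldNormedType.Exports.
Import Order.TTheory GRing.Theory Num.Theory.
Local Open Scope classical_set_scope.
Local Open Scope ring_scope.

(* Write a_v for the sum of the S_e with source v. As distinct edges out of v
   have distinct ranges, a_v a_v^* = P_v and a_v^* a_v is the sum of the P_(r e)
   over the edges e out of v. For the nonnegative coefficients c_v of the
   hypothesis, the 2 |E^0| selfadjoint odd elements sqrt(2 c_v) Re a_v and
   sqrt(2 c_v) Im a_v are then contractions whose squares add up to 1. Each such
   x defines an equivariant homomorphism f |-> f(x) on the cone over Z/2, viewed
   as functions on [-1, 1] vanishing at 0, reparametrized so that t (x) 1
   goes to x^2.

   The functional calculus f(x) comes from the bound |p(x)| <= max |p| over
   [-1, 1] for polynomials p. If |x| < 1, then x = (u^* + u) / 2 for a unitary u,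
   so that p(x) is a Laurent polynomial in u, whose coefficients are bounded by
   max |p| because they are averages over roots of unity. This loses a factor
   linear in the degree, which is removed by applying the bound to the powers
   of p^* p and taking roots. *)

Set Implicit Arguments.
Unset Strict Implicit.
Unset Printing Implicit Defensive.

(** * Real-valued norms over the complex scalars *)

Section RealNorm.
Context {R : realType}.
Notation C := (Cx R).

Lemma ofRE (x y : R) : (ofR x <= ofR y) = (x <= y).
Proof. exact: lecR. Qed.
Lemma ofR_lt (x y : R) : (ofR x < ofR y) = (x < y).
Proof. exact: ltcR. Qed.
Lemma ofRD (x y : R) : ofR (x + y) = ofR x + ofR y.
Proof. exact: rmorphD. Qed.
Lemma ofRN (x : R) : ofR (- x) = - ofR x.
Proof. exact: rmorphN. Qed.
Lemma ofRM (x y : R) : ofR (x * y) = ofR x * ofR y.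
Proof. exact: rmorphM. Qed.
Lemma ofRX (x : R) n : ofR (x ^+ n) = ofR x ^+ n.
Proof. exact: rmorphXn. Qed.
Lemma ofR1 : ofR (1 : R) = 1.
Proof. by []. Qed.
Lemma ofR_nat n : ofR (n%:R : R) = n%:R.
Proof. exact: rmorph_nat. Qed.
Lemma ofRV (x : R) : ofR x^-1 = (ofR x)^-1.
Proof. exact: fmorphV. Qed.
Lemma conj_ofR (x : R) : (ofR x)^* = ofR x.
Proof. by apply: conj_Creal; rewrite complex_real. Qed.

Lemma ofR_inj : injective (@ofR R).
Proof. exact: complexI. Qed.

(** The library norm takes values in [C]. Its real part carries the same information ([rnormE]) and
    puts estimates within reach of [lra] and [nra]. *)
Definition rnorm {V : normedZmodType C} (x : V) : R := complex.Re `|x|.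

Section Zmod.
Context {V : normedZmodType C}.
Implicit Types x y : V.

Lemma rnormE x : ofR (rnorm x) = `|x|.
Proof. by apply: RRe_real; rewrite normr_real. Qed.

Lemma rnorm_ge0 x : 0 <= rnorm x.
Proof. by rewrite -ofRE rnormE; exact: normr_ge0. Qed.

Lemma rnorm_le x c : (rnorm x <= c) = (`|x| <= ofR c).
Proof. by rewrite -ofRE rnormE. Qed.

Lemma rnorm_lt x c : (rnorm x < c) = (`|x| < ofR c).
Proof. by rewrite -ofR_lt rnormE. Qed.

Lemma rnorm0 : rnorm (0 : V) = 0.
Proof. by rewrite /rnorm normr0. Qed.

Lemma rnormN x : rnorm (- x) = rnorm x.
Proof. by rewrite /rnorm normrN. Qed.

Lemma rnormBC x y : rnorm (x - y) = rnorm (y - x).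
Proof. by rewrite /rnorm distrC. Qed.

Lemma rnormD x y : rnorm (x + y) <= rnorm x + rnorm y.
Proof. by rewrite rnorm_le ofRD !rnormE ler_normD. Qed.

Lemma rnormB x y : rnorm (x - y) <= rnorm x + rnorm y.
Proof. by rewrite -(rnormN y) rnormD. Qed.

Lemma rnorm_eq0 x : rnorm x <= 0 -> x = 0.
Proof. by rewrite rnorm_le normr_le0 => /eqP. Qed.

Lemma rnorm_eq x y : (forall eps, 0 < eps -> rnorm (x - y) < eps) -> x = y.
Proof.
move=> xy; apply/subr0_eq/rnorm_eq0; rewrite leNgt; apply/negP => d0.
by have := xy _ d0; rewrite ltxx.
Qed.

Lemma rnorm_sum I (r : seq I) (P : pred I) (F : I -> V) :
  rnorm (\sum_(i <- r | P i) F i) <= \sum_(i <- r | P i) rnorm (F i).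
Proof.
elim/big_ind2 : _ => [|x1 x2 y1 y2 h1 h2|//]; first by rewrite rnorm0.
by apply: le_trans (rnormD _ _) _; rewrite lerD.
Qed.

End Zmod.

Lemma rnorm_ofR (x : R) : rnorm (ofR x : C) = `|x|.
Proof. by rewrite /rnorm normc_def /= expr0n addr0 sqrtr_sqr. Qed.

Lemma rnormCM (x y : C) : rnorm (x * y) = rnorm x * rnorm y.
Proof. by apply: ofR_inj; rewrite ofRM !rnormE normrM. Qed.

Lemma rnormCX (x : C) n : rnorm (x ^+ n) = rnorm x ^+ n.
Proof. by apply: ofR_inj; rewrite ofRX !rnormE normrX. Qed.

Lemma rnorm_conj (x : C) : rnorm (x^*) = rnorm x.
Proof. by rewrite /rnorm norm_conjC. Qed.

Lemma rnormZ (V : normedModType C) (c : C) (x : V) :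
  rnorm (c *: x) = rnorm c * rnorm x.
Proof. by apply: ofR_inj; rewrite ofRM !rnormE normrZ. Qed.

(** Completeness restated with real epsilons, for the fixed point in [sqrt_exists] and the limit in
    [fcalc_exists]. *)
Lemma rnorm_cauchy_lim (V : completeNormedModType C) (u : nat -> V) :
  (forall eps, 0 < eps -> exists N, forall n m, (N <= n)%N -> (N <= m)%N ->
     rnorm (u n - u m) < eps) ->
  exists l, forall eps, 0 < eps -> exists N, forall n, (N <= n)%N ->
     rnorm (u n - l) < eps.
Proof.
move=> uc.
have : cauchy (u @ \oo).
  apply/cauchy_ballP => e e0; near_simpl.
  have er : e = ofR (complex.Re e).
    by rewrite [RHS]RRe_real // realE ltW.
  have r0 : 0 < complex.Re e by rewrite -ofR_lt -er.
  have [N uN] := uc _ r0.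
  exists ([set n | (N <= n)%N], [set n | (N <= n)%N]).
    by split; exists N.
  by move=> [n m] /= [Nn Nm]; rewrite -ball_normE /ball_ /= er -rnorm_lt uN.
move=> /cauchy_cvg/cvg_ex[l ul]; exists l => eps eps0.
have e0 : 0 < ofR eps by rewrite (ofR_lt 0).
have /cvgrPdist_lt/(_ _ e0)[N _ uN] := ul.
by exists N => n Nn; rewrite rnormBC rnorm_lt uN.
Qed.

End RealNorm.

(** * Star-algebra identities and the C*-norm *)

Section Star.
Context {R : realType} {A : starAlgType R}.
Implicit Types x y : A.

Lemma star0 : star (0 : A) = 0.
Proof. by rewrite -[X in star X](scale0r (0 : A)) starZ conjC0 scale0r. Qed.

Lemma starN x : star (- x) = - star x.
Proof. by rewrite -scaleN1r starZ rmorphN rmorph1 scaleN1r. Qed.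

Lemma starB x y : star (x - y) = star x - star y.
Proof. by rewrite starD starN. Qed.

Lemma star_sum I (r : seq I) (P : pred I) (F : I -> A) :
  star (\sum_(i <- r | P i) F i) = \sum_(i <- r | P i) star (F i).
Proof. by apply: (big_morph _ starD star0). Qed.

Lemma amul0l x : amul 0 x = 0.
Proof. by apply: (addIr (amul 0 x)); rewrite -amulDl !add0r. Qed.
Lemma amul0r x : amul x 0 = 0.
Proof. by apply: (addIr (amul x 0)); rewrite -amulDr !add0r. Qed.
Lemma amulNl x y : amul (- x) y = - amul x y.
Proof. by rewrite -scaleN1r amulZl scaleN1r. Qed.
Lemma amulNr x y : amul x (- y) = - amul x y.
Proof. by rewrite -scaleN1r amulZr scaleN1r. Qed.

Lemma amul_suml I (r : seq I) (P : pred I) (F : I -> A) x :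
  amul (\sum_(i <- r | P i) F i) x = \sum_(i <- r | P i) amul (F i) x.
Proof. by rewrite (big_morph (amul^~ x) (fun y z => amulDl y z x) (amul0l x)). Qed.
Lemma amul_sumr I (r : seq I) (P : pred I) (F : I -> A) x :
  amul x (\sum_(i <- r | P i) F i) = \sum_(i <- r | P i) amul x (F i).
Proof. by rewrite (big_morph (amul x) (amulDr x) (amul0r x)). Qed.

End Star.

Section CStarNorm.
Context {R : realType} {A : cstarAlgType R}.
Implicit Types x y : A.

Lemma rnorm_amul x y : rnorm (amul x y) <= rnorm x * rnorm y.
Proof. by rewrite rnorm_le ofRM !rnormE norm_amul. Qed.

Lemma rnorm_star_amul x : rnorm (amul (star x) x) = rnorm x ^+ 2.
Proof. by apply: ofR_inj; rewrite ofRX !rnormE norm_star_amul. Qed.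

(** Cancelling |y| in |y|^2 = |y^* y| <= |y^*| |y| gives one inequality; replacing y by y^* gives
    the other. *)
Lemma rnorm_star x : rnorm (star x) = rnorm x.
Proof.
suff le y : rnorm y <= rnorm (star y).
  by apply/le_anti; rewrite le andbT -{2}(starK x) le.
have [y0|y0] := leP (rnorm y) 0; first by rewrite (le_trans y0) ?rnorm_ge0.
rewrite -(ler_pM2r y0) -expr2 -rnorm_star_amul.
exact: rnorm_amul.
Qed.

Lemma rnorm_amul_self x : star x = x -> rnorm (amul x x) = rnorm x ^+ 2.
Proof. by move=> xx; rewrite -{1}xx rnorm_star_amul. Qed.

End CStarNorm.

(** * C*-algebras with a nonzero identity as rings *)

Section Unitization.
Context (R : realType) (A : cstarAlgType R) (e : A).
Hypotheses (e1 : is_one e) (e0 : e != 0).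

(* The proofs occur in the alias so that the ring instance below can be found
   from the type alone. *)
Definition unital : Type := let _ := (e1, e0) in A.
HB.instance Definition _ := CStarAlg.on unital.

Let mul1 : left_id (e : unital) (@amul R A).
Proof. by move=> x; case: (e1 x). Qed.
Let mulr1 : right_id (e : unital) (@amul R A).
Proof. by move=> x; case: (e1 x). Qed.

HB.instance Definition _ := GRing.Zmodule_isNzRing.Build unital
  (@amulA R A) mul1 mulr1 (@amulDl R A) (@amulDr R A) e0.

Let scaleAl (c : Cx R) (x y : unital) : c *: (x * y) = (c *: x) * y.
Proof. by rewrite [RHS](@amulZl R A). Qed.
Let scaleAr (c : Cx R) (x y : unital) : c *: (x * y) = x * (c *: y).
Proof. by rewrite [RHS](@amulZr R A). Qed.

HB.instance Definition _ := GRing.Lmodule_isLalgebra.Build (Cx R) unital scaleAl.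
HB.instance Definition _ := GRing.Lalgebra_isAlgebra.Build (Cx R) unital scaleAr.
End Unitization.

Section UnitalCStar.
Context {R : realType} {A0 : cstarAlgType R} {e : A0}.
Context {e1 : is_one e} {e0 : e != 0}.
Local Notation A := (unital e1 e0).
Implicit Types x y : A.

Lemma amulE x y : amul x y = x * y.
Proof. by []. Qed.

Lemma mstarM x y : star (x * y) = star y * star x.
Proof. by rewrite -!amulE starM. Qed.

Lemma star1 : star (1 : A) = (1 : A).
Proof.
by rewrite -[LHS](mulr1 (star (1 : A) : A)) -{2}[1 : A]starK -mstarM mulr1 starK.
Qed.

Lemma starX x n : star (x ^+ n) = (star x : A) ^+ n.
Proof. by elim: n => [|n IH]; rewrite ?expr0 ?star1 // exprS mstarM IH exprSr. Qed.

Lemma rnormM x y : rnorm (x * y) <= rnorm x * rnorm y.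
Proof. by rewrite -amulE rnorm_amul. Qed.

Lemma rnorm_starM x : rnorm ((star x : A) * x) = rnorm x ^+ 2.
Proof. by rewrite -amulE rnorm_star_amul. Qed.

(** The C*-identity at 1 reads |1|^2 = |1|, and |1| = 0 is excluded by [e0]. *)
Lemma rnorm1 : rnorm (1 : A) = 1.
Proof.
have : rnorm (1 : A) * (rnorm (1 : A) - 1) = 0.
  by rewrite mulrBr -expr2 mulr1 -rnorm_starM star1 mulr1 subrr.
move/eqP; rewrite mulf_eq0 subr_eq0 => /orP[/eqP n0|/eqP //].
have /eqP := @rnorm_eq0 _ _ (1 : A) (eq_ind_r (fun z => z <= 0) (lexx 0) n0).
by rewrite oner_eq0.
Qed.

Lemma rnorm_isometry x : (star x : A) * x = 1 -> rnorm x = 1.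
Proof.
move=> xx; have : rnorm x ^+ 2 = 1 by rewrite -rnorm_starM xx rnorm1.
by move/eqP; rewrite sqrp_eq1 ?rnorm_ge0 // => /eqP.
Qed.

Lemma rnormX_le1 x n : rnorm x <= 1 -> rnorm (x ^+ n) <= 1.
Proof.
move=> x1; elim: n => [|n IH]; first by rewrite expr0 rnorm1.
rewrite exprS (le_trans (rnormM _ _)) // -[leRHS]mulr1.
by rewrite ler_pM ?rnorm_ge0.
Qed.

End UnitalCStar.

(** * Coefficient bounds through roots of unity *)

Section PrimitiveRoot.
Context {R : realType}.

(** ['X^n - 1] splits and is separable in characteristic 0, so it has n distinct roots, and these
    include a primitive one. *)
Lemma prim_root_exists n : (n > 0)%N -> exists z : Cx R, n.-primitive_root z.
Proof.
pose p : {poly Cx R} := 'X^n - 1; have [r Dp] := closed_field_poly_normal p.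
move=> n_gt0; rewrite (monicP _) ?monicXnsubC // scale1r in Dp.
have rn1: all n.-unity_root r by apply/allP=> z; rewrite -root_prod_XsubC -Dp.
have sz_r: (n < (size r).+1)%N.
  by rewrite -(size_prod_XsubC r id) -Dp size_XnsubC.
have [|z] := hasP (cyclic.has_prim_root n_gt0 rn1 _ sz_r); last by exists z.
rewrite -separable.separable_prod_XsubC -Dp cyclotomic.separable_Xn_sub_1 //.
by rewrite pnatr_eq0 -lt0n.
Qed.

(** The number i + s + 1 is positive and less than twice the modulus s + k + 1, so it could only
    equal the modulus, which forces i = k. *)
Lemma dvdn_offset (s k i : nat) : (i < s)%N -> i <> k ->
  ~~ ((s + k).+1 %| i + ((s + k).+1 - k))%N.
Proof.
by move=> si ik; apply/negP => /dvdnP[[|[|c]]]; rewrite ?mulSn; lia.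
Qed.

(* Discrete Fourier inversion over the M-th roots of unity. *)
Lemma rnorm_coef_le (q : {poly Cx R}) (B : R) k :
  (forall z : Cx R, rnorm z = 1 -> rnorm q.[z] <= B) -> rnorm q`_k <= B.
Proof.
(* [M] exceeds k and the degree of [q], so that no exponent of [q] other than k is congruent to k
   modulo [M]. *)
move=> qB; pose M := (size q + k).+1.
have [w wM] := @prim_root_exists M isT.
have w1 i : rnorm (w ^+ i) = 1.
  have : rnorm w ^+ M = 1.
    by rewrite -rnormCX (prim_expr_order wM) -ofR1 rnorm_ofR normr1.
  move/eqP; rewrite pexpr_eq1 ?rnorm_ge0 // => /eqP w1.
  by rewrite rnormCX w1 expr1n.
have geo m : ~~ (M %| m)%N -> \sum_(j < M) (w ^+ m) ^+ j = 0.
  move=> Mm; have : (w ^+ m - 1) * \sum_(j < M) (w ^+ m) ^+ j = 0.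
    by rewrite -subrX1 -exprM mulnC exprM (prim_expr_order wM) expr1n subrr.
  by move/eqP; rewrite mulf_eq0 subr_eq0 -(prim_order_dvd wM) (negbTE Mm) => /eqP.
have dft : M%:R * q`_k = \sum_(j < M) q.[w ^+ j] * w ^+ (j * (M - k)).
  under eq_bigr => j _.
    rewrite horner_coef mulr_suml.
    under eq_bigr => i _ do
      rewrite -mulrA -exprM -exprD -mulnDr mulnC exprM.
    over.
  rewrite exchange_big /=.
  under eq_bigr => i _ do rewrite -mulr_sumr.
  have off (i : 'I_(size q)) : (i : nat) <> k ->
      \sum_(j < M) (w ^+ (i + (M - k))) ^+ j = 0.
    by move=> ik; apply: geo; apply: dvdn_offset.
  case: (ltnP k (size q)) => [kq|qk]; last first.
    rewrite nth_default // mulr0 big1 // => i _; rewrite off ?mulr0 //.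
    by move=> ik; have := ltn_ord i; rewrite ik ltnNge qk.
  rewrite (bigD1 (Ordinal kq)) //= [X in _ + X]big1 ?addr0 => [|i ik].
    rewrite subnKC; last by rewrite /M ltnW // ltnS leq_addl.
    rewrite (prim_expr_order wM).
    under eq_bigr do rewrite expr1n.
    by rewrite sumr_const card_ord -mulr_natl mulrC.
  rewrite off ?mulr0 // => ik'.
  by move/eqP: ik; apply; apply: val_inj.
have M0 : 0 < (M%:R : R) by rewrite ltr0n.
rewrite -(ler_pM2l M0).
have -> : M%:R * rnorm q`_k = rnorm (M%:R * q`_k : Cx R).
  by rewrite rnormCM -ofR_nat rnorm_ofR ger0_norm ?ltW.
rewrite dft (le_trans (rnorm_sum _ _ _)) // mulr_natl.
rewrite -[X in _ *+ X]card_ord -sumr_const.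
by apply: ler_sum => j _; rewrite rnormCM w1 mulr1 qB.
Qed.

End PrimitiveRoot.

(** * The Joukowski substitution *)

Section Joukowski.
Context {R : realType}.
Notation C := (Cx R).

(** For d at least the degree of p, this is z^d p((z + z^-1) / 2), cleared of negative powers of
    z. *)
Definition joukowski (d : nat) (p : {poly C}) : {poly C} :=
  \sum_(i < d.+1) p`_i *: ('X^(d - i) * (2^-1 *: ('X^2 + 1)) ^+ i).

Lemma size_joukowski d p : (size (joukowski d p) <= d.*2.+1)%N.
Proof.
apply: (leq_trans (size_sum _ _ _)); apply/bigmax_leqP => i _.
apply: (leq_trans (size_scale_leq _ _)).
apply: (leq_trans (size_polyMleq _ _)); rewrite size_polyXn.
have : (size ((2^-1 *: ('X^2 + 1) : {poly C}) ^+ i) <= (2 * i).+1)%N.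
  apply: (leq_trans (size_poly_exp_leq _ _)).
  rewrite ltnS leq_mul2r; apply/orP; right.
  rewrite -subn1 leq_subLR; apply: (leq_trans (size_scale_leq _ _)).
  by rewrite (leq_trans (size_polyD _ _)) // size_polyXn size_poly1.
rewrite addSn /= => sz; apply: (leq_trans (leq_add (leqnn _) sz)).
by have := ltn_ord i; rewrite -addnn; lia.
Qed.

(** With y = (z + zi) / 2 one has (z^2 + 1) / 2 = z y, and z commutes with y, so z^(d - i) (z y)^i =
    z^d y^i. A general algebra [B] covers both uses: complex numbers of modulus 1 and unitaries. *)
Lemma horner_joukowski (B : algType C) (z zi : B) d (p : {poly C}) :
  z * zi = 1 -> zi * z = 1 -> (size p <= d.+1)%N ->
  horner_alg z (joukowski d p) =
  z ^+ d * horner_alg (2^-1 *: (z + zi)) p.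
Proof.
move=> zzi ziz sp.
rewrite [in RHS](_ : p = \sum_(i < d.+1) p`_i *: 'X^i); last first.
  by rewrite -poly_def; apply/polyP => i; rewrite coef_poly;
     case: ltnP => // di; rewrite nth_default ?(leq_trans sp).
rewrite !linear_sum mulr_sumr; apply: eq_bigr => i _ /=.
rewrite !linearZ /= !mulr_algl -scalerAr; congr (_ *: _).
rewrite !rmorphM !rmorphXn /= linearZ /= mulr_algl rmorphD rmorphXn rmorph1 /= !horner_algX.
set y := 2^-1 *: (z + zi).
have -> : 2^-1 *: (z ^+ 2 + 1) = z * y.
  by rewrite /y -scalerAr mulrDr zzi expr2.
have cy : GRing.comm z y.
  by rewrite /GRing.comm /y -scalerAr -scalerAl mulrDr mulrDl zzi ziz.
by rewrite exprMn_comm // mulrA -exprD subnK // -ltnS ltn_ord.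
Qed.

End Joukowski.

(** * Real inequalities *)

Section RealLemmas.
Context {R : realType}.

Lemma expr_small (r eps : R) : 0 <= r -> r < 1 -> 0 < eps ->
  exists N, forall n, (N <= n)%N -> r ^+ n < eps.
Proof.
move=> r0 r1 eps0; have r1' : `|r| < 1 by rewrite ger0_norm.
have /cvgrPdist_lt/(_ _ eps0)[N _ H] := cvg_expr r1'.
exists N => n /H /=; rewrite sub0r normrN ger0_norm //.
exact: exprn_ge0.
Qed.

(** If y = (1 + d) B with d > 0, the powers of 1 + d outgrow the linear factor. Precisely, for M =
    2^j Bernoulli's inequality gives (M d)^2 <= (1 + d)^(2 M) <= 4 s M + 1 <= M (4 s + 1), hence M
    d^2 <= 4 s + 1. *)
Lemma le_of_expr_le (y B : R) (s : nat) : 0 <= B ->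
  (forall k, y ^+ (2 ^ k) <= (2 * s * 2 ^ k + 1)%N%:R * B ^+ (2 ^ k)) -> y <= B.
Proof.
move=> B0 H; rewrite leNgt; apply/negP => By.
have [B00|Bp] := leP B 0.
  have B00' : B = 0 by apply/le_anti; rewrite B00.
  by have := H 0%N; rewrite expn0 !expr1 B00' mulr0 leNgt -{1}B00' By.
set d := y / B - 1.
have d0 : 0 < d by rewrite subr_gt0 ltr_pdivlMr // mul1r.
have yE : y = (1 + d) * B by rewrite /d addrCA subrr addr0 divfK ?gt_eqF.
have bern n : 1 + n%:R * d <= (1 + d) ^+ n.
  elim: n => [|n IH]; first by rewrite mul0r addr0 expr0.
  rewrite exprS -nat1r; apply: (@le_trans _ _ ((1 + d) * (1 + n%:R * d))).
    have : 0 <= n%:R * d * d by rewrite !mulr_ge0 // ltW.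
    lra.
  by rewrite ler_pM2l // addr_gt0.
(* Chosen so that j + 1 > (4 s + 1) / d^2; as 2^j >= j + 1, this contradicts M d^2 <= 4 s + 1. *)
pose j := Num.truncn ((4 * s + 1)%N%:R / d ^+ 2).
have := H j.+1; rewrite yE exprMn ler_pM2r ?exprn_gt0 //.
rewrite expnS mulnC exprM; set M := (2 ^ j)%N => H1.
have M1 : (1 <= M)%N by rewrite expn_gt0.
have Md : M%:R * d <= (1 + d) ^+ M by have := bern M; lra.
have Md0 : 0 <= M%:R * d by rewrite mulr_ge0 // ltW.
have H2 : (M%:R * d) ^+ 2 <= (2 * s * (M * 2) + 1)%N%:R.
  by apply: le_trans H1; rewrite ler_pXn2r ?nnegrE // exprn_ge0 // addr_ge0 ?ltW.
have H3 : (2 * s * (M * 2) + 1)%N%:R <= (M%:R : R) * (4 * s + 1)%N%:R.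
  by rewrite -natrM ler_nat; nia.
have Mp : 0 < (M%:R : R) by rewrite ltr0n.
have H4 : (M%:R : R) * d ^+ 2 <= (4 * s + 1)%N%:R.
  by rewrite -(ler_pM2l Mp); apply: le_trans H3; apply: le_trans H2; rewrite exprMn mulrA.
have : (j.+1)%:R <= (4 * s + 1)%N%:R / d ^+ 2.
  rewrite ler_pdivlMr ?exprn_gt0 //; apply: le_trans H4.
  by rewrite ler_pM2r ?exprn_gt0 // ler_nat ltn_expl.
by apply/negP; rewrite -ltNge; exact: truncnS_gt.
Qed.

End RealLemmas.

(** * Selfadjoint strict contractions as real parts of unitaries *)

Section Sqrt.
Context {R : realType} {A0 : cstarAlgType R} {e : A0}.
Context {e1 : is_one e} {e0 : e != 0}.
Local Notation A := (unital e1 e0).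
Implicit Types x y h : A.

Lemma half_half (x : A) : (2^-1 : Cx R) *: (x + x) = x.
Proof. 
have h : (2^-1 + 2^-1 : Cx R) = 1 by field.
by rewrite scalerDr -scalerDl h scale1r. Qed.

Lemma rnorm_half (x : A) : rnorm ((2^-1 : Cx R) *: x) = 2^-1 * rnorm x.
Proof.
have -> : (2^-1 : Cx R) = ofR (2^-1) by rewrite ofRV ofR_nat.
by rewrite rnormZ rnorm_ofR ger0_norm.
Qed.

(* With k = 1 - w the equation h^2 + w^2 = 1 reads k = (h^2 + k^2) / 2, whose
   right-hand side is a contraction on the ball of radius |h|. *)
Lemma sqrt_exists h : star h = h -> rnorm h < 1 ->
  exists w : A, [/\ star w = w, w * h = h * w & h * h + w * w = 1].
Proof.
move=> hs h1; set r := rnorm h.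
have r0 : 0 <= r by exact: rnorm_ge0.
pose F (x : A) : A := (2^-1 : Cx R) *: (h * h + x * x).
pose k n := iter n F 0.
have kS n : k n.+1 = F (k n) by [].
have kr n : rnorm (k n) <= r.
  elim: n => [|n IH]; first by rewrite rnorm0.
  rewrite kS rnorm_half.
  have := rnormD (h * h) (k n * k n).
  have := rnormM h h; have := rnormM (k n) (k n).
  have := rnorm_ge0 (k n); rewrite -/r; nra.
(* In a^2 - b^2 = a (a - b) + (a - b) b both terms are at most r |a - b|, and the factor 1/2 in [F]
   leaves a contraction by r. *)
have kd n p : rnorm (k (n + p)%N - k n) <= r ^+ n.
  elim: n p => [|n IH] p.
    by rewrite add0n subr0 expr0 (le_trans (kr p)) // ltW.
  rewrite addSn !kS /F -scalerBr rnorm_half [h * h + _]addrC addrKA.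
  set a := k (n + p)%N; set b := k n.
  have -> : a * a - b * b = a * (a - b) + (a - b) * b.
    by rewrite mulrBr mulrBl addrA subrK.
  have := rnormD (a * (a - b)) ((a - b) * b).
  have := rnormM a (a - b); have := rnormM (a - b) b.
  have := kr (n + p)%N; have := kr n; rewrite -/a -/b.
  have := IH p; rewrite -/a -/b.
  have := rnorm_ge0 a; have := rnorm_ge0 b; have := rnorm_ge0 (a - b).
  rewrite exprS; move: (r ^+ n) (rnorm (a - b)) (rnorm a) (rnorm b) => *; nra.
have [l kl] : exists l : A, forall eps, 0 < eps -> exists N, forall n,
    (N <= n)%N -> rnorm (k n - l) < eps.
  apply: rnorm_cauchy_lim => eps eps0.
  have eps2 : 0 < eps / 2 by rewrite divr_gt0.
  have [N rN] := expr_small r0 h1 eps2.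
  exists N => n m Nn Nm.
  have Hn : rnorm (k n - k N) <= r ^+ N by rewrite -(subnKC Nn) kd.
  have Hm : rnorm (k m - k N) <= r ^+ N by rewrite -(subnKC Nm) kd.
  have := rN N (leqnn _); have := rnormB (k n - k N) (k m - k N).
  rewrite opprB addrA subrK; lra.
(* Equations satisfied by all iterates pass to the limit if [G] is Lipschitz at [l]; this serves for
   selfadjointness and for commutation with [h]. *)
have lim0 (C : R) (G : A -> A) : 0 < C ->
    (forall n, rnorm (G l - G (k n)) <= C * rnorm (k n - l)) ->
    (forall n, G (k n) = 0) -> G l = 0.
  move=> C0 GC Gk; apply: rnorm_eq => eps eps0.
  have [N HN] := kl _ (divr_gt0 eps0 C0).
  have := GC N; rewrite Gk; have := HN N (leqnn _).
  by rewrite ltr_pdivlMr // mulrC => H1 H2; exact: le_lt_trans H2 H1.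
have ks n : star (k n) = k n.
  elim: n => [|n IH]; first exact: star0.
  rewrite kS /F starZ starD !mstarM hs IH; congr (_ *: _).
  by rewrite conj_Creal // rpredV realn.
have kh n : k n * h - h * k n = 0.
  elim: n => [|n /subr0_eq IH]; first by rewrite mul0r mulr0 subrr.
  apply/eqP; rewrite subr_eq0 kS /F -scalerAl -scalerAr mulrDl mulrDr -!mulrA.
  by rewrite IH [k n * (h * _)]mulrA IH -mulrA.
have ls : star l = l.
  apply: subr0_eq; apply: (lim0 2 (fun x => star x - x)) => // n; last first.
    by rewrite ks subrr.
  have -> : star l - l - (star (k n) - k n) = star (l - k n) + (k n - l).
    by rewrite starB opprB [k n - star _]addrC addrACA [- l + _]addrC.
  by have := rnormD (star (l - k n)) (k n - l); rewrite rnorm_star (rnormBC l); lra.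
have lh : l * h = h * l.
  apply: subr0_eq; apply: (lim0 (2 * r + 1) (fun x => x * h - h * x)) => // [|n].
    lra.
  rewrite kh subr0.
  rewrite (_ : l * h - h * l = (l - k n) * h - h * (l - k n)); last first.
    by have /subr0_eq E := kh n; rewrite mulrBl mulrBr E opprB addrA subrK.
  have := rnormB ((l - k n) * h) (h * (l - k n)).
  have := rnormM (l - k n) h; have := rnormM h (l - k n).
  rewrite (rnormBC l) -/r; have := rnorm_ge0 (k n - l); nra.
have lF : l = F l.
  apply: rnorm_eq => eps eps0.
  have [N HN] : exists N, forall n, (N <= n)%N ->
      rnorm (k n - l) < Num.min 1 (eps / 4).
    by apply: kl; rewrite lt_min ltr01 divr_gt0.
  have := HN N.+1 (leqnSn _); have := HN N (leqnn _).
  rewrite !lt_min => /andP[a1 a2] /andP[b1 b2].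
  have D : rnorm (l - F l) <= rnorm (l - k N.+1) + rnorm (k N.+1 - F l).
    by have := rnormD (l - k N.+1) (k N.+1 - F l); rewrite addrA subrK.
  have : rnorm (k N.+1 - F l) <= 2^-1 * ((2 * r + 1) * rnorm (k N - l)).
    rewrite kS /F -scalerBr rnorm_half [h * h + _]addrC addrKA ler_pM2l ?invr_gt0 //.
    have -> : k N * k N - l * l = k N * (k N - l) + (k N - l) * l.
      by rewrite mulrBr mulrBl addrA subrK.
    have := rnormD (k N * (k N - l)) ((k N - l) * l).
    have := rnormM (k N) (k N - l); have := rnormM (k N - l) l.
    have : rnorm l <= r + 1.
      have := rnormD (l - k N) (k N); rewrite subrK (rnormBC l).
      have := kr N; lra.
    have := kr N; have := rnorm_ge0 (k N - l); nra.
  have := rnorm_ge0 (k N - l); rewrite (rnormBC l (k _)) in D.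
  have : (1 - r) * rnorm (k N - l) >= 0 by rewrite mulr_ge0 ?rnorm_ge0 // subr_ge0 ltW.
  lra.
exists (1 - l); split.
- by rewrite starB star1 ls.
- by rewrite mulrBl mulrBr mul1r mulr1 lh.
- have E : l + l = h * h + l * l.
    by rewrite {1 2}lF /F -scalerDr half_half.
  rewrite mulrBl !mulrBr !mul1r mulr1 opprB addrCA -!addrA.
  rewrite [h * h + _]addrCA.
  have -> : l * l = l + l - h * h by rewrite E addrC addKr.
  by rewrite [_ + (h * h - l)]addrA subrK addrK addNr addr0.
Qed.

(** Take u = h + i w with the w of [sqrt_exists]. As h and w are commuting selfadjoint elements, u^*
    u and u u^* both equal h^2 + w^2 = 1. *)
Lemma unitary_real_part h : star h = h -> rnorm h < 1 ->
  exists u : A, [/\ (star u : A) * u = 1, u * star u = 1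
                  & h = (2^-1 : Cx R) *: (u + star u)].
Proof.
move=> hs /(sqrt_exists hs)[w [ws wh hw]]; pose u : A := h + 'i *: w.
have us : star u = h - 'i *: w.
  by rewrite /u starD starZ hs ws conjCi scaleNr.
exists u; rewrite us; split.
- rewrite mulrBl !mulrDr -!scalerAl -!scalerAr scalerA -['i * 'i]expr2 sqrCi scaleN1r wh.
  by rewrite opprD opprK addrA addrK.
- rewrite mulrBr !mulrDl -!scalerAl -!scalerAr scalerA -['i * 'i]expr2 sqrCi scaleN1r wh.
  by rewrite opprD opprK addrA addrK.
- by rewrite /u addrACA subrr addr0 half_half.
Qed.

End Sqrt.

(** * Polynomial evaluation and the unit circle *)

Section Horner.
Context {R : realType}.
Notation C := (Cx R).

(** Allows [horner_joukowski] to be applied to scalars, with [C] as an algebra over itself. *)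
Lemma horner_alg_regular (z : C) (p : {poly C}) :
  horner_alg (z : C^o) p = p.[z].
Proof.
elim/poly_ind: p => [|p c IH]; first by rewrite rmorph0 horner0.
by rewrite rmorphD rmorphM /= horner_algX horner_algC IH hornerMXaddC /= -[c%:A]/(c * 1) mulr1.
Qed.

Lemma horner_alg_coef (B : algType C) (z : B) (p : {poly C}) :
  horner_alg z p = \sum_(i < size p) p`_i *: z ^+ i.
Proof.
rewrite -{1}[p]coefK poly_def linear_sum; apply: eq_bigr => i _ /=.
by rewrite linearZ /= mulr_algl rmorphXn /= horner_algX.
Qed.

Lemma conj_horner (p : {poly C}) (s : R) :
  (map_poly Num.conj p).[ofR s] = (p.[ofR s])^*.
Proof. by rewrite -{1}(conj_ofR s) horner_map. Qed.

Lemma unit_circle_real_part (z : C) : rnorm z = 1 ->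
  exists s : R, [/\ -1 <= s <= 1, z != 0 & 2^-1 * (z + z^-1) = ofR s].
Proof.
move=> z1; have z1' : `|z| = 1 by rewrite -rnormE z1.
have z0 : z != 0 by rewrite -normr_eq0 z1' oner_neq0.
exists (complex.Re z); split=> //.
  have := normc_ge_Re z; rewrite z1' -[1]/(ofR 1) lecR => H.
  by rewrite -ler_norml.
have -> : z^-1 = z^* by rewrite invC_norm z1' expr1n invr1 mul1r.
by rewrite mulrC; exact/esym/ReJ_add.
Qed.

End Horner.

(** * The norm of a polynomial in a selfadjoint contraction *)

Section PolyBound.
Context {R : realType} {A0 : cstarAlgType R} {e : A0}.
Context {e1 : is_one e} {e0 : e != 0}.
Local Notation A := (unital e1 e0).
Notation C := (Cx R).
Implicit Types (x y h : A) (p q : {poly C}).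

Lemma star_horner_alg h p :
  star (horner_alg h p) = horner_alg (star h : A) (map_poly Num.conj p).
Proof.
rewrite !horner_alg_coef star_sum size_map_poly.
by apply: eq_bigr => i _; rewrite starZ starX coef_map.
Qed.

(** For h the real part of the unitary u and d = [size p], p(h) is the d-th power of u^* times q(u),
    where q is the Joukowski polynomial. On the unit circle |q(z)| = |p(Re z)| <= B, so each of the
    at most 2 d + 1 coefficients of q is bounded by B. *)
Lemma horner_alg_crude_bound h p (B : R) : star h = h -> rnorm h < 1 ->
  (forall s, -1 <= s <= 1 -> rnorm p.[ofR s] <= B) ->
  rnorm (horner_alg h p) <= (2 * size p + 1)%N%:R * B.
Proof.
move=> hs h1 pB; have [u [uu1 uu2 hu]] := unitary_real_part hs h1.
have B0 : 0 <= B by apply: le_trans (pB 0 _); rewrite ?rnorm_ge0 ?lerN10 ?ler01.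
have u1 : rnorm u <= 1 by rewrite (rnorm_isometry uu1).
set d := size p; set q := joukowski d p.
have qB k : rnorm q`_k <= B.
  apply: rnorm_coef_le => z /[dup] z1 /unit_circle_real_part[s [s1 z0 zs]].
  rewrite -horner_alg_regular (@horner_joukowski _ C^o z (z^-1 : C)) ?mulfV ?mulVf //.
  rewrite horner_alg_regular [2^-1 *: _]zs rnormCM rnormCX z1 expr1n mul1r.
  exact: pB.
have -> : horner_alg h p = (star u : A) ^+ d * horner_alg u q.
  rewrite (@horner_joukowski _ A u (star u)) // -hu mulrA -exprMn_comm; last first.
    by rewrite /GRing.comm uu1 uu2.
  by rewrite uu1 expr1n mul1r.
apply: (le_trans (rnormM _ _)).
have us1 : rnorm ((star u : A) ^+ d) <= 1 by apply: rnormX_le1; rewrite rnorm_star.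
apply: (@le_trans _ _ (rnorm (horner_alg u q))).
  by rewrite -[leRHS]mul1r ler_wpM2r ?rnorm_ge0.
rewrite horner_alg_coef (le_trans (rnorm_sum _ _ _)) //.
apply: (@le_trans _ _ (\sum_(i < size q) B)).
  apply: ler_sum => i _; rewrite rnormZ -[leRHS]mulr1.
  by rewrite ler_pM ?rnorm_ge0 ?rnormX_le1.
rewrite sumr_const card_ord -[B *+ _]mulr_natl ler_wpM2r // ler_nat addn1 mul2n.
exact: size_joukowski.
Qed.

Lemma rnorm_expr2n x n : star x = x -> rnorm (x ^+ (2 ^ n)) = rnorm x ^+ (2 ^ n).
Proof.
move=> xs; elim: n => [|n IH]; first by rewrite expn0 !expr1.
rewrite expnSr !exprM -IH expr2 -amulE rnorm_amul_self //.
by rewrite starX xs.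
Qed.

(** By the C*-identity |p(h)|^2 = |q(h)| for q the product of p and its conjugate, and |q(h)|^N =
    |q^N(h)| for N = 2^k. The crude bound for q^N costs a factor linear in N, which [le_of_expr_le]
    removes. *)
Lemma horner_alg_strict_bound h p (B : R) : star h = h -> rnorm h < 1 ->
  (forall s, -1 <= s <= 1 -> rnorm p.[ofR s] <= B) ->
  rnorm (horner_alg h p) <= B.
Proof.
move=> hs h1 pB; set x := horner_alg h p.
have B0 : 0 <= B by apply: le_trans (pB 0 _); rewrite ?rnorm_ge0 ?lerN10 ?ler01.
rewrite -(@ler_pXn2r _ 2) ?nnegrE ?rnorm_ge0 // -rnorm_starM.
pose q := map_poly Num.conj p * p.
have xq : (star x : A) * x = horner_alg h q.
  by rewrite star_horner_alg hs -rmorphM.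
have xs : star ((star x : A) * x) = (star x : A) * x by rewrite mstarM starK.
(* The successor makes room for q = 0, where the general bound on the size of [q ^+ N] is 1. *)
apply: (@le_of_expr_le _ _ _ (size q).+1) => [|k]; first exact: exprn_ge0.
rewrite -rnorm_expr2n // xq -rmorphXn /=.
set N := (2 ^ k)%N.
have qB s : -1 <= s <= 1 -> rnorm (q ^+ N).[ofR s] <= (B ^+ 2) ^+ N.
  move=> /pB ps; rewrite horner_exp rnormCX lerXn2r ?nnegrE ?rnorm_ge0 ?exprn_ge0 //.
  by rewrite hornerM conj_horner rnormCM rnorm_conj expr2 ler_pM ?rnorm_ge0.
apply: (le_trans (horner_alg_crude_bound hs h1 qB)).
rewrite ler_wpM2r ?exprn_ge0 ?exprn_ge0 // ler_nat leq_add2r -mulnA leq_mul2l /=.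
have N1 : (1 <= N)%N by rewrite expn_gt0.
by have := size_poly_exp_leq q N; case: (size q) => [|s] /=; nia.
Qed.

(** The strict bound applies to r h with r = 1 - d < 1. Since 1 - r^i <= d i, the values p(h) and
    p(r h) differ by at most d K, where K is the sum of the i |p_i|, and d is chosen with d K <=
    eps. *)
Lemma horner_alg_bound h p (B : R) : star h = h -> rnorm h <= 1 ->
  (forall s, -1 <= s <= 1 -> rnorm p.[ofR s] <= B) ->
  rnorm (horner_alg h p) <= B.
Proof.
move=> hs h1 pB; apply/ler_addgt0Pr => eps eps0.
pose K := \sum_(i < size p) rnorm p`_i * i%:R.
have K0 : 0 <= K by apply: sumr_ge0 => i _; rewrite mulr_ge0 ?rnorm_ge0.
pose d := Num.min 2^-1 (eps / (K + 1)).
have d0 : 0 < d by rewrite lt_min invr_gt0 ltr0n divr_gt0 // ltr_wpDl.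
have d2 : d <= 2^-1 by rewrite ge_min lexx.
have dK : d * K <= eps.
  have : d * (K + 1) <= eps by rewrite -ler_pdivlMr ?ltr_wpDl // ge_min lexx orbT.
  by apply: le_trans; rewrite ler_pM2l // lerDl.
pose r := 1 - d.
have r01 : 0 <= r /\ r < 1 by rewrite /r; split; lra.
have [r0 r1] := r01.
pose g : A := (ofR r : C) *: h.
have gs : star g = g by rewrite starZ conj_ofR hs.
have g1 : rnorm g < 1.
  rewrite rnormZ rnorm_ofR ger0_norm //.
  by have := rnorm_ge0 h; nra.
have gB := horner_alg_strict_bound gs g1 pB.
suff : rnorm (horner_alg h p - horner_alg g p) <= d * K.
  have := rnormD (horner_alg h p - horner_alg g p) (horner_alg g p).
  rewrite subrK; lra.
rewrite !horner_alg_coef -sumrB (le_trans (rnorm_sum _ _ _)) // mulr_sumr.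
apply: ler_sum => i _; rewrite -scalerBr rnormZ mulrCA ler_wpM2l ?rnorm_ge0 //.
rewrite exprZn -{1}[h ^+ i]scale1r -scalerBl rnormZ -ofRX -ofR1 -ofRN -ofRD rnorm_ofR.
have ri : 1 - r ^+ i <= d * i%:R.
  elim: (i : nat) => [|n IH]; first by rewrite expr0 subrr mulr0.
  have rn : r ^+ n <= 1 by rewrite exprn_ile1 // ltW.
  have rE : r = 1 - d by [].
  rewrite exprS -nat1r; move: (r ^+ n) (n%:R : R) IH rn => y m; nra.
have ri1 : r ^+ i <= 1 by rewrite exprn_ile1 // ltW.
rewrite ger0_norm ?subr_ge0 // (le_trans _ ri) // -[leRHS]mulr1.
by rewrite ler_wpM2l ?subr_ge0 // rnormX_le1.
Qed.

End PolyBound.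

(** * Weierstrass approximation by Bernstein polynomials *)

Section Bernstein.
Context {R : realType}.
Notation C := (Cx R).

(* The Bernstein sum of the g k binom(n, k) 'X^k (1 - 'X)^(n - k), through
   Pascal's rule; bernstein_mean is its value at t for real data. *)
Fixpoint bernstein n (g : nat -> C) : {poly C} :=
  if n is n'.+1 then
    (1 - 'X) * bernstein n' g + 'X * bernstein n' (fun k => g k.+1)
  else (g 0%N)%:P.

Fixpoint bernstein_mean n (g : nat -> R) (t : R) : R :=
  if n is n'.+1 then
    (1 - t) * bernstein_mean n' g t + t * bernstein_mean n' (fun k => g k.+1) t
  else g 0%N.

(** For t in [0, 1] each recursion step is a convex combination, so pointwise bounds on the distance
    to c are averaged. *)
Lemma bernstein_dist n (g : nat -> C) (c : C) (G : nat -> R) (t : R) :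
  0 <= t <= 1 -> (forall k, (k <= n)%N -> rnorm (g k - c) <= G k) ->
  rnorm ((bernstein n g).[ofR t] - c) <= bernstein_mean n G t.
Proof.
move=> /andP[t0 t1]; elim: n g G => [|n IH] g G gG /=.
  by rewrite hornerC gG.
rewrite hornerD !hornerM hornerD hornerN hornerX hornerC.
set x := horner _ _; set y := horner _ _.
have -> : (1 - ofR t) * x + ofR t * y - c =
    ofR (1 - t) * (x - c) + ofR t * (y - c).
  by rewrite ofRD ofRN ofR1; ring.
apply: (le_trans (rnormD _ _)); rewrite !rnormCM !rnorm_ofR !ger0_norm ?subr_ge0 //.
by apply: lerD; rewrite ler_wpM2l ?subr_ge0 // IH // => k kn; apply: gG => //; exact: ltnW.
Qed.

(** The second moment of the binomial distribution about s: squared bias (n t - s)^2 plus variance n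
    t (1 - t). *)
Lemma bernstein_mean_sqr n (a b s t : R) :
  bernstein_mean n (fun k => a + b * (k%:R - s) ^+ 2) t =
  a + b * ((n%:R * t - s) ^+ 2 + n%:R * t * (1 - t)).
Proof.
elim: n s => [|n IH] s /=; first by ring.
rewrite IH.
under [X in bernstein_mean n X]eq_fun => k.
  rewrite (_ : k.+1%:R - s = k%:R - (s - 1)); last by rewrite -nat1r; ring.
  over.
by rewrite IH -nat1r; ring.
Qed.

(** Uniform continuity in the form of a quadratic majorant, whose Bernstein mean is known from
    [bernstein_mean_sqr]. *)
Lemma compact_modulus (f : R -> C) (eps : R) : continuous f -> 0 < eps ->
  exists2 K, 0 <= K & forall s t, 0 <= s <= 1 -> 0 <= t <= 1 ->
    rnorm (f s - f t) <= eps + K * (s - t) ^+ 2.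
Proof.
move=> fc eps0; have cpt := @segment_compact R 0 1.
have near_f (x e : R) : 0 < e ->
    exists2 d, 0 < d & forall y, `|y - x| < d -> rnorm (f y - f x) < e.
  move=> e0; have e0' : 0 < ofR e by rewrite (ofR_lt 0).
  have /cvgrPdist_lt/(_ _ e0')/nbhs_ballP[d /= d0 H] := fc x.
  exists d => // y yx; rewrite rnormBC rnorm_lt; apply: H.
  by rewrite /ball /= distrC.
have [M fM] : exists M, forall s, 0 <= s <= 1 -> rnorm (f s) <= M.
  have := (compact_near_coveringP _).1 cpt R (pinfty_nbhs R)
    (fun M s => rnorm (f s) <= M) _.
  case=> [x _|M [_ H]]; last first.
    by exists (M + 1) => s s01; apply: (H (M + 1)); rewrite ?ltrDl // /= in_itv.
  have [d d0 H] := near_f x 1 ltr01.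
  exists (ball x d, [set M | rnorm (f x) + 1 < M]).
    by split => /=; [exact: nbhsx_ballx|exists (rnorm (f x) + 1); split => //; exact: num_real].
  move=> [y M'] /= [+ M'f]; rewrite /ball /= distrC => /H yx.
  have := rnormD (f y - f x) (f x); rewrite subrK; lra.
have [d d0 fd] : exists2 d, 0 < d & forall s t, 0 <= s <= 1 -> `|t - s| < d ->
    rnorm (f t - f s) < eps.
  (* Compactness along d -> 0+: half the modulus of continuity at x serves all points close to x. *)
  have := (compact_near_coveringP _).1 cpt R (at_right (0:R))
    (fun d s => forall t, `|t - s| < d -> rnorm (f t - f s) < eps) _.
  case=> [x _|d /= d0 H]; last first.
    exists (d / 2); rewrite ?divr_gt0 // => s t s01.
    apply: (H (d / 2)); rewrite /= ?in_itv ?divr_gt0 //.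
    by rewrite sub0r normrN gtr0_norm ?divr_gt0 // ltr_pdivrMr // ltr_pMr // ltr1n.
  have e2 : 0 < eps / 2 by rewrite divr_gt0.
  have [d d0 H] := near_f x _ e2.
  have d2 : 0 < d / 2 by rewrite divr_gt0.
  exists (ball x (d / 2), [set d' | d' < d / 2]).
    split => /=; first exact: nbhsx_ballx.
    by exists (d / 2) => // y; rewrite /ball_ /= sub0r normrN => /ltr_normlW.
  move=> [y d'] /= [+ d'd] t ty; rewrite /ball /= distrC => yx.
  have yd : `|y - x| < d by lra.
  have td : `|t - x| < d by have := ler_normD (t - y) (y - x); rewrite subrKA; lra.
  have := H _ td; have := H _ yd; have := rnormB (f t - f x) (f y - f x).
  rewrite opprB addrA subrK; lra.
have M0 : 0 <= M by apply: le_trans (fM 0 _); rewrite ?rnorm_ge0 ?lexx ?ler01.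
(* Points closer than d contribute at most eps; for the others (s - t)^2 / d^2 >= 1, and 2 M bounds
   any difference of values. *)
exists (2 * M / d ^+ 2) => [|s t s01 t01].
  by rewrite divr_ge0 ?sqr_ge0 ?mulr_ge0.
have [st|st] := ltP `|s - t| d.
  have := fd _ _ t01 st; have : 0 <= 2 * M / d ^+ 2 * (s - t) ^+ 2.
    by rewrite mulr_ge0 ?sqr_ge0 // divr_ge0 ?sqr_ge0 ?mulr_ge0.
  lra.
have : 2 * M <= 2 * M / d ^+ 2 * (s - t) ^+ 2.
  rewrite -mulrA ler_peMr ?mulr_ge0 // mulrC ler_pdivlMr ?exprn_gt0 // mul1r.
  by rewrite -[leRHS]real_normK ?num_real // ler_pXn2r // nnegrE ltW.
by have := rnormB (f s) (f t); have := fM _ s01; have := fM _ t01; lra.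
Qed.

Lemma weierstrass01 (f : R -> C) (eps : R) : continuous f -> 0 < eps ->
  exists p : {poly C}, forall t, 0 <= t <= 1 -> rnorm (p.[ofR t] - f t) <= eps.
Proof.
move=> fc eps0; have eps2 : 0 < eps / 2 by rewrite divr_gt0.
have [K K0 fK] := compact_modulus fc eps2.
(* The variance term of the mean is (K / n) t (1 - t), so K / n <= eps / 2 is enough. *)
pose n := (Num.truncn (K / (eps / 2))).+1.
have n0 : 0 < (n%:R : R) by rewrite ltr0n.
have nK : K / n%:R <= eps / 2.
  by rewrite ler_pdivrMr // mulrC -ler_pdivrMr //; apply: ltW; exact: truncnS_gt.
exists (bernstein n (fun k => f (k%:R / n%:R))) => t t01.
apply: le_trans (bernstein_dist
  (G := fun k => eps / 2 + K / n%:R ^+ 2 * (k%:R - n%:R * t) ^+ 2) t01 _) _.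
  move=> k kn; have kn01 : 0 <= (k%:R / n%:R : R) <= 1.
    by rewrite divr_ge0 //= ler_pdivrMr // mul1r ler_nat.
  apply: le_trans (fK _ _ kn01 t01) _; rewrite lerD2l.
  by rewrite le_eqVlt; apply/orP; left; apply/eqP; field; rewrite gt_eqF.
rewrite bernstein_mean_sqr subrr expr0n add0r.
have -> : K / n%:R ^+ 2 * (n%:R * t * (1 - t)) = (K / n%:R) * (t * (1 - t)).
  by field; rewrite gt_eqF.
have : 0 <= K / n%:R by rewrite divr_ge0 // ltW.
move: (K / n%:R) nK t01 => z nK /andP[t0 t1] z0; nra.
Qed.

Lemma weierstrass (f : R -> C) (eps : R) : continuous f -> 0 < eps ->
  exists p : {poly C}, forall s, -1 <= s <= 1 -> rnorm (p.[ofR s] - f s) <= eps.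
Proof.
move=> fc eps0.
have gc : continuous (fun t : R => f (2 * t - 1)).
  move=> t; apply: (@continuous_comp _ _ _ (fun t : R => 2 * t - 1) f); last exact: fc.
  by apply: cvgB; [apply: cvgM; [exact: cvg_cst|exact: cvg_id]|exact: cvg_cst].
have [p pf] := weierstrass01 gc eps0.
exists (p \Po ((2^-1)%:P * ('X + 1))) => s s1.
rewrite horner_comp hornerM hornerD hornerX !hornerC.
have -> : 2^-1 * (ofR s + 1) = ofR (2^-1 * (s + 1)) :> C.
  by rewrite ofRM ofRV ofR_nat ofRD.
have := pf (2^-1 * (s + 1)).
have -> : 2 * (2^-1 * (s + 1)) - 1 = s by field.
by apply; lra.
Qed.

End Bernstein.

(** * Contractivity of unital homomorphisms *)

Section Contractive.
Context {R : realType} {A0 : cstarAlgType R} {e : A0}.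
Context {e1 : is_one e} {e0 : e != 0}.
Local Notation A := (unital e1 e0).
Notation C := (Cx R).
Variable phi : A -> A.
Hypotheses (phi_hom : star_hom phi) (phi1 : phi 1 = 1).

Let phiZ (c : C) (x : A) : phi (c *: x) = c *: phi x.
Proof.
have [lin _ _] := phi_hom; have phi0 : phi 0 = 0.
  by have := lin (-1) 0 0; rewrite scaler0 addr0 scaleN1r addNr.
by have := lin c x 0; rewrite phi0 !addr0.
Qed.

Let phiD (x y : A) : phi (x + y) = phi x + phi y.
Proof. by have [lin _ _] := phi_hom; have := lin 1 x y; rewrite !scale1r. Qed.

Let phiM (x y : A) : phi (x * y) = phi x * phi y.
Proof. by have [_ mul _] := phi_hom; exact: mul. Qed.

Let phi_star (x : A) : phi (star x) = star (phi x).
Proof. by have [_ _ st] := phi_hom. Qed.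

Lemma hom_horner_alg (x : A) (p : {poly C}) :
  phi (horner_alg x p) = horner_alg (phi x) p.
Proof.
elim/poly_ind: p => [|p c IH].
  by rewrite !rmorph0; have := phiZ 0 0; rewrite !scale0r.
rewrite !rmorphD !rmorphM /= !horner_algX !horner_algC phiD phiM IH.
by rewrite phiZ phi1.
Qed.

(* A selfadjoint strict contraction is the real part of a unitary, and phi
   maps unitaries to unitaries, which have norm 1. *)
Lemma unital_hom_contractive (x : A) : rnorm (phi x) <= rnorm x.
Proof.
have strict (h : A) : star h = h -> rnorm h < 1 -> rnorm (phi h) <= 1.
  move=> hs h1; have [u [uu _ ->]] := unitary_real_part hs h1.
  have u1 : rnorm (phi u) = 1 by apply: rnorm_isometry; rewrite -phi_star -phiM uu.
  rewrite phiZ rnorm_half phiD phi_star.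
  by have := rnormD (phi u) (star (phi u)); rewrite rnorm_star u1; lra.
have sa (h : A) : star h = h -> rnorm (phi h) <= rnorm h.
  move=> hs; apply/ler_addgt0Pr => eps eps0.
  have r0 : 0 < rnorm h + eps by rewrite ltr_wpDl ?rnorm_ge0.
  have r0' : 0 <= (rnorm h + eps)^-1 by rewrite invr_ge0 ltW.
  have := strict (ofR (rnorm h + eps)^-1 *: h).
  rewrite phiZ !rnormZ rnorm_ofR ger0_norm // starZ conj_ofR hs => /(_ erefl).
  by rewrite ![_^-1 * _]mulrC ltr_pdivrMr // ler_pdivrMr // !mul1r ltrDl; exact.
rewrite -(@ler_pXn2r _ 2) ?nnegrE ?rnorm_ge0 // -!rnorm_starM.
by rewrite -phi_star -phiM sa // mstarM starK.
Qed.

End Contractive.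

(** * Continuous functional calculus on [-1, 1] *)

Section FunctionalCalculus.
Context {R : realType} {A0 : cstarAlgType R} {e : A0}.
Context {e1 : is_one e} {e0 : e != 0}.
Local Notation A := (unital e1 e0).
Notation C := (Cx R).
Implicit Types (f g : R -> C) (p q : {poly C}) (h l : A).

Definition approx p f (eps : R) :=
  forall s, -1 <= s <= 1 -> rnorm (p.[ofR s] - f s) <= eps.

(* Reads l = f(h). *)
Definition is_fcalc h f l :=
  forall p (eps : R), approx p f eps -> rnorm (horner_alg h p - l) <= eps.

(** [weierstrass] supplies approximating polynomials of every accuracy, and their values at h are
    close to both l and l'. *)
Lemma fcalc_unique h f l l' : continuous f ->
  is_fcalc h f l -> is_fcalc h f l' -> l = l'.
Proof.
move=> fc fl fl'; apply: rnorm_eq => eps eps0.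
have e4 : 0 < eps / 4 by rewrite divr_gt0.
have [p pf] := weierstrass fc e4.
have := fl _ _ pf; have := fl' _ _ pf.
have := rnormB (horner_alg h p - l') (horner_alg h p - l).
by rewrite opprB addrC addrA subrK; lra.
Qed.

Section Calculus.
Variable h : A.
Hypotheses (hs : star h = h) (h1 : rnorm h <= 1).

Let approx_dist p q f (a b : R) : approx p f a -> approx q f b ->
  rnorm (horner_alg h p - horner_alg h q) <= a + b.
Proof.
move=> pf qf; rewrite -rmorphB; apply: horner_alg_bound => // s s1.
rewrite hornerD hornerN; have := pf _ s1; have := qf _ s1.
have := rnormB (p.[ofR s] - f s) (q.[ofR s] - f s).
by rewrite opprB addrA subrK; lra.
Qed.

(** One approximant per accuracy suffices: by [horner_alg_bound] any two approximants of f have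
    nearby values at h. *)
Lemma fcalc_intro f l :
  (forall eps, 0 < eps -> exists2 p, approx p f eps &
     rnorm (horner_alg h p - l) <= eps) -> is_fcalc h f l.
Proof.
move=> H p eps pf; apply/ler_addgt0Pr => d d0.
have d2 : 0 < d / 2 by rewrite divr_gt0.
have [q qf ql] := H _ d2; have := approx_dist pf qf.
have := rnormD (horner_alg h p - horner_alg h q) (horner_alg h q - l).
by rewrite addrA subrK; lra.
Qed.

Lemma fcalc_exists f : continuous f -> exists l, is_fcalc h f l.
Proof.
move=> fc; have ex n : exists p, approx p f (n.+1%:R^-1).
  by apply: weierstrass; rewrite ?invr_gt0.
have [p pf] := choice ex.
have small (eps : R) : 0 < eps -> exists N, forall n, (N <= n)%N -> n.+1%:R^-1 < eps.
  move=> eps0; exists (Num.truncn eps^-1) => n Nn.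
  rewrite invf_plt ?posrE //; apply: lt_le_trans (truncnS_gt _) _.
  by rewrite ler_nat.
have [l pl] : exists l : A, forall eps, 0 < eps -> exists N, forall n,
    (N <= n)%N -> rnorm (horner_alg h (p n) - l) < eps.
  apply: rnorm_cauchy_lim => eps eps0.
  have e2 : 0 < eps / 2 by rewrite divr_gt0.
  have [N HN] := small _ e2.
  exists N => n m /HN Nn /HN Nm; apply: le_lt_trans (approx_dist (pf n) (pf m)) _.
  by rewrite [ltRHS]splitr ltrD.
exists l; apply: fcalc_intro => eps eps0.
have [N1 H1] := small _ eps0; have [N2 H2] := pl _ eps0.
exists (p (maxn N1 N2)); last by apply/ltW/H2; rewrite leq_maxr.
by move=> s s1; apply: le_trans (pf _ _ s1) _; apply/ltW/H1; rewrite leq_maxl.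
Qed.

(** f lies within 1 of a polynomial, which on [-1, 1] is bounded by the sum of the absolute values
    of its coefficients. *)
Lemma approx_bounded f : continuous f ->
  exists2 M, 0 <= M & forall s, -1 <= s <= 1 -> rnorm (f s) <= M.
Proof.
move=> fc; have [p pf] := weierstrass fc ltr01.
exists (\sum_(i < size p) rnorm p`_i + 1) => [|s s1].
  by rewrite addr_ge0 // sumr_ge0 // => i _; exact: rnorm_ge0.
have : rnorm p.[ofR s] <= \sum_(i < size p) rnorm p`_i.
  rewrite horner_coef (le_trans (rnorm_sum _ _ _)) //; apply: ler_sum => i _.
  rewrite rnormCM rnormCX rnorm_ofR -[leRHS]mulr1 ler_wpM2l ?rnorm_ge0 //.
  by rewrite exprn_ile1 // ler_norml.
have := pf _ s1; have := rnormB p.[ofR s] (p.[ofR s] - f s).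
by rewrite opprB addrC subrK; lra.
Qed.

Lemma fcalc_lin (c : C) f g l l' : continuous f -> continuous g ->
  is_fcalc h f l -> is_fcalc h g l' ->
  is_fcalc h (fun s => c * f s + g s) (c *: l + l').
Proof.
move=> fc gc fl gl; apply: fcalc_intro => eps eps0.
have c0 : 0 < rnorm c + 1 by rewrite ltr_wpDl ?rnorm_ge0.
have d0 : 0 < eps / (rnorm c + 1) by rewrite divr_gt0.
have [p pf] := weierstrass fc d0; have [q qg] := weierstrass gc d0.
have E : rnorm c * (eps / (rnorm c + 1)) + eps / (rnorm c + 1) = eps.
  by field; rewrite gt_eqF.
exists (c *: p + q) => [s s1|].
  rewrite hornerD hornerZ.
  have -> : c * p.[ofR s] + q.[ofR s] - (c * f s + g s) =
      c * (p.[ofR s] - f s) + (q.[ofR s] - g s) by ring.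
  apply: le_trans (rnormD _ _) _; rewrite -E rnormCM.
  by rewrite lerD ?ler_wpM2l ?rnorm_ge0 ?pf ?qg.
rewrite rmorphD /= linearZ /= mulr_algl opprD addrACA -scalerBr.
apply: le_trans (rnormD _ _) _; rewrite -E rnormZ.
by rewrite lerD ?ler_wpM2l ?rnorm_ge0 ?fl ?gl.
Qed.

Lemma fcalc_mul f g l l' : continuous f -> continuous g ->
  is_fcalc h f l -> is_fcalc h g l' -> is_fcalc h (fun s => f s * g s) (l * l').
Proof.
move=> fc gc fl gl; apply: fcalc_intro => eps eps0.
have [M M0 fM] := approx_bounded fc; have [N N0 gN] := approx_bounded gc.
(* [T * d] dominates both error terms, (M + 1) d + d N for the functions and (M + 1) d + d |l'| in
   the algebra; d <= 1 keeps |p| below M + 1. *)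
pose T := M + 1 + N + rnorm l'.
have T0 : 0 < T by rewrite /T; have := rnorm_ge0 l'; lra.
pose d := Num.min 1 (eps / T).
have d0 : 0 < d by rewrite lt_min ltr01 divr_gt0.
have d1 : d <= 1 by rewrite ge_min lexx.
have dT : T * d <= eps by rewrite mulrC -ler_pdivlMr // ge_min lexx orbT.
have [p pf] := weierstrass fc d0; have [q qg] := weierstrass gc d0.
have pM s : -1 <= s <= 1 -> rnorm p.[ofR s] <= M + 1.
  move=> s1; have := rnormD (p.[ofR s] - f s) (f s); rewrite subrK.
  by have := pf _ s1; have := fM _ s1; lra.
exists (p * q) => [s s1|].
  rewrite hornerM.
  have -> : p.[ofR s] * q.[ofR s] - f s * g s =
    p.[ofR s] * (q.[ofR s] - g s) + (p.[ofR s] - f s) * g s by ring.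
  apply: le_trans (rnormD _ _) _; rewrite !rnormCM.
  apply: (@le_trans _ _ ((M + 1) * d + d * N)).
    by rewrite lerD ?ler_pM ?rnorm_ge0 ?pM ?qg ?pf ?gN.
  have := mulr_ge0 (rnorm_ge0 l') (ltW d0); move: dT; rewrite /T; lra.
rewrite rmorphM /=; set x := horner_alg h p; set y := horner_alg h q.
have -> : x * y - l * l' = x * (y - l') + (x - l) * l'.
  by rewrite mulrBr mulrBl addrA subrK.
have xM : rnorm x <= M + 1 by apply: horner_alg_bound.
apply: le_trans (rnormD _ _) _.
apply: (@le_trans _ _ ((M + 1) * d + d * rnorm l')).
  apply: lerD; first by rewrite (le_trans (rnormM _ _)) ?ler_pM ?rnorm_ge0 ?gl.
  by rewrite (le_trans (rnormM _ _)) ?ler_pM ?rnorm_ge0 ?fl.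
have := mulr_ge0 N0 (ltW d0); move: dT; rewrite /T; lra.
Qed.

Lemma fcalc_star f l : continuous f ->
  is_fcalc h f l -> is_fcalc h (fun s => (f s)^*) (star l).
Proof.
move=> fc fl; apply: fcalc_intro => eps eps0.
have [p pf] := weierstrass fc eps0.
exists (map_poly Num.conj p) => [s s1|].
  by rewrite conj_horner -rmorphB rnorm_conj pf.
by rewrite -{1}hs -star_horner_alg -starB rnorm_star fl.
Qed.

End Calculus.

(** [phi] commutes with polynomial evaluation and does not increase norms. With [fcalc_opp] this
    yields equivariance. *)
Lemma fcalc_hom (phi : A -> A) h f l : star_hom phi -> phi 1 = 1 ->
  is_fcalc h f l -> is_fcalc (phi h) f (phi l).
Proof.
move=> phih phi1 fl p eps /fl; apply: le_trans.
rewrite -(hom_horner_alg phih phi1).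
have [lin _ _] := phih.
have E := lin (-1) l (horner_alg h p); rewrite !scaleN1r ![- _ + _]addrC in E.
by rewrite -E unital_hom_contractive.
Qed.

Lemma fcalc_opp h f l : is_fcalc (- h) f l -> is_fcalc h (fun s => f (- s)) l.
Proof.
move=> fl p eps pf.
have -> : horner_alg h p = horner_alg (- h) (p \Po - 'X).
  elim/poly_ind: p {pf} => [|p c IH]; first by rewrite comp_poly0 !rmorph0.
  rewrite comp_polyD comp_polyM comp_polyX comp_polyC !rmorphD !rmorphM /=.
  by rewrite IH rmorphN /= !horner_algX !horner_algC opprK.
apply: fl => s s1; rewrite horner_comp hornerN hornerX -ofRN -[in f s](opprK s).
by apply: pf; lra.
Qed.

End FunctionalCalculus.

(** * The cone over Z/2 as functions on [-1, 1] *)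

Section ConeFun.
Context {R : realType}.
Notation C := (Cx R).
Implicit Types f g : cone R Z2.

(* Turns f into a function on [-1, 1]: the half-lines are the two copies of
   (0, 1], and the square reparametrizes them so that cone_t1 becomes s ^ 2. *)
Definition cone_fun f (s : R) : C :=
  if insub (Num.min (s ^+ 2) 1) is Some t then f (t : Ioc01 R, (s < 0) : Z2) else 0.

Lemma cone_fun_lin (c : C) f g :
  cone_fun (c *: f + g) = (fun s => c * cone_fun f s + cone_fun g s).
Proof. by apply/funext => s; rewrite /cone_fun; case: insub => //; rewrite mulr0 addr0. Qed.

Lemma cone_fun_mul f g :
  cone_fun (amul f g) = (fun s => cone_fun f s * cone_fun g s).
Proof. by apply/funext => s; rewrite /cone_fun; case: insub => //; rewrite mulr0. Qed.

Lemma cone_fun_star f : cone_fun (star f) = (fun s => (cone_fun f s)^*).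
Proof. by apply/funext => s; rewrite /cone_fun; case: insub => //; rewrite conjC0. Qed.

(** The minimum with 1 keeps the square in (0, 1], so [cone_fun] takes its default value 0 only at s
    = 0, where continuity demands it. *)
Lemma insub_min_sqr (s : R) : s != 0 ->
  exists2 t : Ioc01 R, insub (Num.min (s ^+ 2) 1) = Some t &
    Ioc01_val t = Num.min (s ^+ 2) 1.
Proof.
move=> s0; case: insubP => [t _ tE|]; first by exists t.
have s2 : 0 < s ^+ 2 by rewrite exprn_even_gt0.
by case/negP; apply/mem_set; rewrite /= in_itv /= lt_min s2 ltr01 ge_min lexx orbT.
Qed.

Lemma insub_min_sqr0 : insub (Num.min (0 ^+ 2 : R) 1) = None :> option (Ioc01 R).
Proof.
rewrite expr0n /= min_l ?ler01 //; case: insubP => // t /set_mem /=.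
by rewrite in_itv /= ltxx.
Qed.

Lemma cone_fun_t1 (s : R) : -1 <= s <= 1 ->
  cone_fun (cone_t1 R Z2) s = ofR (s ^+ 2).
Proof.
move=> s1; rewrite /cone_fun; have [->|s0] := eqVneq s 0.
  by rewrite insub_min_sqr0 expr0n.
have [t -> tE] := insub_min_sqr s0; rewrite -[LHS]/(ofR (Ioc01_val t)) tE.
by rewrite min_l // -real_normK ?num_real // exprn_ile1 // ler_norml.
Qed.

Lemma cone_fun_act f : cone_fun (cone_act (true : Z2) f) = (fun s => cone_fun f (- s)).
Proof.
apply/funext => s; rewrite /cone_fun sqrrN.
have [->|s0] := eqVneq s 0; first by rewrite insub_min_sqr0.
have [t -> _ /=] := insub_min_sqr s0; congr (C0_fun f (t, _)).
transitivity (~~ (s < 0)); first exact: addbT.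
by rewrite oppr_lt0 -leNgt le_eqVlt eq_sym (negbTE s0).
Qed.

(** At 0, f is small off a compact set whose projection to (0, 1] is compact, hence closed in R and
    away from 0. Elsewhere the sign of s is locally constant, and [cone_fun f] agrees near s with f
    composed with a continuous map. *)
Lemma cone_fun_continuous f : continuous (cone_fun f).
Proof.
have [fc f0] := C0P f; move=> s.
have [->|s0] := eqVneq s 0.
  rewrite /continuous_at {2}/cone_fun insub_min_sqr0.
  apply/cvgrPdist_lt => eps eps0.
  have [K cK fK] := f0 _ eps0.
  pose v (p : Ioc01 R * Z2) := Ioc01_val p.1.
  have cv : continuous v.
    by move=> p; apply: continuous_comp; [exact: cvg_fst|exact: Ioc01_val_continuous].
  have vK : compact (v @` K) by apply: continuous_compact => //; exact: continuous_subspaceT.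
  have vKc : closed (v @` K) by apply: compact_closed => //; exact: norm_hausdorff.
  have n0 : (~` (v @` K)) 0.
    move=> [p _ vp]; have := set_valP p.1; rewrite /= in_itv /= => /andP[p0 _].
    by have : 0 < v p := p0; rewrite vp ltxx.
  have /nbhs_ballP[d /= d0 dK] : nbhs (0 : R) (~` (v @` K)).
    by apply: open_nbhs_nbhs; split => //; exact: closed_openC.
  apply/nbhs_ballP; exists (Num.min 1 d); first by rewrite /= lt_min ltr01.
  move=> r; rewrite /ball /= sub0r normrN lt_min => /andP[r1 rd].
  rewrite sub0r normrN /cone_fun; have [->|r0] := eqVneq r 0.
    by rewrite insub_min_sqr0 normr0.
  have [t -> tE] := insub_min_sqr r0; apply: fK => Kt.
  apply: (dK (v (t, (r < 0) : Z2))); last by exists (t, (r < 0) : Z2).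
  have r2 : r ^+ 2 = `|r| * `|r| by rewrite -expr2 real_normK ?num_real.
  have rr : r ^+ 2 <= `|r| by rewrite r2 ler_piMr // ltW.
  rewrite /ball /= sub0r normrN /v /= tE min_l; last by rewrite (le_trans rr) // ltW.
  by rewrite ger0_norm ?sqr_ge0 // (le_lt_trans rr).
(* If r is within |s| / 2 of s then r^2 >= s^2 / 4, so clamping from below at [e] does not affect r
   near s, yet makes the map into (0, 1] total. *)
pose b : Z2 := s < 0; pose e := Num.min (s ^+ 2 / 4) 1.
have s20 : 0 < s ^+ 2 by rewrite exprn_even_gt0.
have e0 : 0 < e by rewrite lt_min ltr01 divr_gt0.
have e1 : e <= 1 by rewrite ge_min lexx orbT.
have clampP (x : R) : Num.max e (Num.min x 1) \in (`]0, 1]%classic : set R).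
  by apply/mem_set; rewrite /= in_itv /= lt_max e0 ge_max e1 ge_min lexx orbT.
pose clamp (x : R) : Ioc01 R := exist (fun y : R => y \in `]0, 1]%classic) _ (clampP x).
have clamp_continuous : continuous clamp.
  apply: continuous_comp_initial => x.
  have cmin : {for x, continuous (fun y : R => Num.min y 1)}.
    by apply: (@continuous_min _ _ id (fun=> 1)); [exact: cvg_id|exact: cvg_cst].
  apply: (@continuous_max R R (fun=> e) (fun y => Num.min y 1) x) => //.
  exact: cvg_cst.
have near_clamp : {near s, (fun r => f (clamp (r ^+ 2), b)) =1 cone_fun f}.
  have s2 : 0 < `|s| / 2 by rewrite divr_gt0 // normr_gt0.
  apply/nbhs_ballP; exists (`|s| / 2) => //= r; rewrite /ball /= => sr.
  have rb : (r < 0) = b.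
    rewrite /b; move: sr s0; case: (ltrgt0P s) => // sp; rewrite ltr_norml => /andP[] *.
      by apply/negbTE; rewrite -leNgt; lra.
    by lra.
  have r2 : s ^+ 2 / 4 <= r ^+ 2.
    have : `|s| / 2 <= `|r| by have := ler_normD (s - r) r; rewrite subrK; lra.
    rewrite -[s ^+ 2]real_normK ?num_real // -[r ^+ 2]real_normK ?num_real //.
    have := normr_ge0 r; move: (`|r|) (`|s|) s2 => x y *; nra.
  have r0 : r != 0.
    by apply: contraTneq r2 => ->; rewrite expr0n /= -ltNge divr_gt0.
  have [t tS tE] := insub_min_sqr r0.
  rewrite /cone_fun tS rb; congr (C0_fun f (_, _)); apply: val_inj => /=.
  rewrite -[RHS]/(Ioc01_val t) tE max_r // /e le_min !ge_min r2 lexx /=.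
  by rewrite orbT.
have fs : cone_fun f s = f (clamp (s ^+ 2), b).
  by have /nbhs_singleton := near_clamp.
rewrite /continuous_at fs.
apply: cvg_trans; first exact: (near_eq_cvg near_clamp).
apply: (@continuous_comp R (Ioc01 R * Z2)%type C
  (fun r : R => (clamp (r ^+ 2), b)) (C0_fun f) s); last exact: fc.
apply: (@cvg_pair _ _ _ (nbhs s) (nbhs (clamp (s ^+ 2))) (nbhs b)).
  apply: (@continuous_comp R R (Ioc01 R) (fun r : R => r ^+ 2) clamp s).
    exact: exprn_continuous.
  exact: clamp_continuous.
exact: cvg_cst.
Qed.

End ConeFun.

(** * Equivariant homomorphisms from odd selfadjoint contractions *)

Section ConeHom.
Context {R : realType} {A0 : cstarAlgType R} {e : A0}.
Context {e1 : is_one e} {e0 : e != 0}.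
Local Notation A := (unital e1 e0).

(** The image of 1 is a left unit on the image of [alpha g], which is all of A since [alpha g] is
    invertible. *)
Lemma action_one (alpha : Z2 -> A -> A) (g : Z2) : is_action alpha -> alpha g 1 = 1.
Proof.
move=> act; have surj y : exists x, y = alpha g x.
  by exists (alpha (g^-1)%g y); rewrite -(actionM act) mulgV (action1 act).
have [_ mul _] := action_hom act g.
have [z z1] := surj 1.
have : alpha g (1 * z) = alpha g 1 * alpha g z := mul 1 z.
by rewrite mul1r -z1 mulr1.
Qed.

(** [rho f] is chosen as the functional calculus of [cone_fun f] at x; uniqueness turns each
    identity required of [rho] into a rule of the calculus. *)
Lemma cone_hom (alpha : Z2 -> A -> A) (x : A) : is_action alpha ->
  star x = x -> rnorm x <= 1 -> alpha true x = - x ->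
  exists rho : cone R Z2 -> A, [/\ star_hom rho,
    equivariant (@cone_act R Z2) alpha rho & rho (cone_t1 R Z2) = x * x].
Proof.
move=> act xs x1 xodd.
have [rho rhoP] := choice (fun f => fcalc_exists xs x1 (cone_fun_continuous (f := f))).
have uniq f l : is_fcalc x (cone_fun f) l -> rho f = l.
  by move=> H; apply: fcalc_unique (rhoP f) H; exact: cone_fun_continuous.
exists rho; split.
- split.
  + move=> c f g; apply: uniq; rewrite cone_fun_lin.
    by apply: fcalc_lin => //; exact: cone_fun_continuous.
  + move=> f g; apply: uniq; rewrite cone_fun_mul.
    by apply: fcalc_mul => //; exact: cone_fun_continuous.
  + move=> f; apply: uniq; rewrite cone_fun_star.
    by apply: fcalc_star => //; exact: cone_fun_continuous.
- case=> f; last first.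
    rewrite (action1 act); congr rho; apply: C0_ext => -[t b] /=.
    by congr (C0_fun f (t, _)); exact: addbF.
  (* The automorphism sends f(x) to f(-x), the value at x of the reflected function. *)
  apply: uniq; rewrite cone_fun_act; apply: fcalc_opp; rewrite -xodd.
  by apply: fcalc_hom (rhoP f); [exact: (action_hom act)|exact: action_one].
apply: uniq; have -> : x * x = horner_alg x ('X ^+ 2).
  by rewrite rmorphXn /= horner_algX expr2.
apply: fcalc_intro => // eps eps0; exists ('X ^+ 2); last by rewrite subrr rnorm0 ltW.
by move=> s s1; rewrite cone_fun_t1 // hornerXn ofRX subrr rnorm0 ltW.
Qed.

End ConeHom.

(** * Relations in Cuntz-Krieger families *)

Section CuntzKrieger.
Context {R : realType} {E : digraph} {A : cstarAlgType R}.
Context {P : vert E -> A} {S : edge E -> A}.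
Hypothesis CK : CK_family P S.

(** Insert the range projections: S_f^* S_e = S_f^* (S_f S_f^* S_e S_e^* ) S_e, whose middle factor
    vanishes. *)
Lemma CK_star_orth f e : f != e -> amul (star (S f)) (S e) = 0.
Proof.
move=> fe; have SK g : amul (amul (star (S g)) (S g)) (star (S g)) = star (S g).
  by rewrite -[in RHS](CK_pisom CK g) !starM starK amulA.
rewrite -{1}(SK f) -{1}(CK_pisom CK e).
rewrite -(amulA (star (S f))) -amulA [amul (amul (S f) _) _]amulA.
by rewrite (CK_range_orth CK) // amul0l amul0r.
Qed.

Lemma CK_mul_rng e : amul (S e) (P (rng e)) = S e.
Proof. by rewrite -(CK_source CK) amulA (CK_pisom CK). Qed.

Lemma CK_mul_src e : amul (P (src e)) (S e) = S e.
Proof.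
rewrite (CK_sum CK); last by exists e.
rewrite amul_suml (bigD1 e) //= (CK_pisom CK) big1 ?addr0 // => f /andP[_ fe].
by rewrite -amulA CK_star_orth // amul0r.
Qed.

Lemma CK_proj_norm v : rnorm (P v) <= 1.
Proof.
have [PP Ps] := CK_proj CK v; have := rnorm_amul_self Ps; rewrite PP.
have := rnorm_ge0 (P v); nra.
Qed.

Lemma CK_mul_star_rng e f : rng e != rng f -> amul (S e) (star (S f)) = 0.
Proof.
move=> ef; rewrite -(CK_mul_rng e) -(CK_mul_rng f) starM.
have [_ ->] := CK_proj CK (rng f).
by rewrite amulA -(amulA (S e)) (CK_proj_orth CK) // amul0r amul0l.
Qed.

(** The element a_v of the outline. *)
Definition out_sum v : A := \sum_(e | src e == v) S e.

Lemma out_sum_star_mul v :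
  amul (star (out_sum v)) (out_sum v) = \sum_(e | src e == v) P (rng e).
Proof.
rewrite /out_sum star_sum amul_suml; apply: eq_bigr => e ev.
rewrite amul_sumr (bigD1 e) //= big1 ?addr0 ?(CK_source CK) // => f /andP[_ fe].
by rewrite CK_star_orth // eq_sym.
Qed.

(** Distinct edges out of v have distinct ranges, which kills the mixed terms S_e S_f^*; the
    remaining ones add up to P_v because v emits an edge. *)
Lemma out_sum_mul_star v : ~ is_sink v ->
  (forall e f : edge E, src e = src f -> rng e = rng f -> e = f) ->
  amul (out_sum v) (star (out_sum v)) = P v.
Proof.
move=> /existsNP[e0 /negP/negPn/eqP e0v] simple.
rewrite (CK_sum CK); last by exists e0.
rewrite /out_sum star_sum amul_suml; apply: eq_bigr => e /eqP ev.
rewrite amul_sumr (bigD1 e) ?ev //= big1 ?addr0 // => f /andP[/eqP fv fe].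
rewrite CK_mul_star_rng //; apply: contra_neq fe => ef.
by apply: simple => //; rewrite fv.
Qed.

(** Each term S_e S_f equals S_e P_(r e) P_v S_f, which vanishes as r e differs from v. *)
Lemma out_sum_sqr v : (forall e, src e = v -> rng e <> v) ->
  amul (out_sum v) (out_sum v) = 0.
Proof.
move=> noloop; rewrite /out_sum amul_suml big1 // => e /eqP ev.
rewrite amul_sumr big1 // => f /eqP fv.
rewrite -(CK_mul_rng e) -(CK_mul_src f) amulA -(amulA (S e)) (CK_proj_orth CK).
  by rewrite amul0r amul0l.
by rewrite fv; apply/eqP; exact: noloop.
Qed.

(** The elements on which u acts as a two-sided identity form a closed star-subalgebra containing
    all generators. *)
Lemma sum_proj_is_one : (forall D : set A, closed D -> star_subalg D ->
    (forall v, D (P v)) -> (forall e, D (S e)) -> D = setT) ->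
  is_one (\sum_v P v).
Proof.
move=> gen; set u := \sum_v P v.
pose D : set A := [set x | amul u x = x /\ amul x u = x].
suff DT : D = setT by move=> x; have : D x by rewrite DT.
have us : star u = u.
  by rewrite star_sum; apply: eq_bigr => v _; case: (CK_proj CK v).
have uP v : amul u (P v) = P v.
  rewrite amul_suml (bigD1 v) //= big1 ?addr0; first by case: (CK_proj CK v).
  by move=> w wv; rewrite (CK_proj_orth CK).
have Pu v : amul (P v) u = P v.
  by case: (CK_proj CK v) => _ Ps; rewrite -Ps -us -starM uP.
apply: gen => [x clx|||e]; last first.
- split; first by rewrite -(CK_mul_src e) amulA uP.
  by rewrite -(CK_mul_rng e) -amulA Pu.
- by move=> v; split.
- split.
  + by split; rewrite ?amul0l ?amul0r.
  + move=> c x y [x1 x2] [y1 y2].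
    by split; rewrite ?amulDr ?amulDl ?amulZr ?amulZl ?x1 ?x2 ?y1 ?y2.
  + by move=> x y [x1 x2] [y1 y2]; split; rewrite ?amulA ?x1 // -amulA y2.
  + by move=> x [x1 x2]; split; rewrite -{1}us -starM ?x1 ?x2.
(* Closedness of [D]: for y in [D], u x - x = u (x - y) - (x - y) has norm at most (|u| + 1) |x -
   y|. *)
have near (eps : R) : 0 < eps -> exists2 y, D y & rnorm (x - y) < eps.
  move=> eps0; have e0 : 0 < ofR eps by rewrite (ofR_lt 0).
  have [y [Dy]] := clx _ (nbhsx_ballx x _ e0).
  by rewrite -ball_normE /ball_ /= -rnorm_lt; exists y.
have u0 : 0 < rnorm u + 1 by rewrite ltr_wpDl ?rnorm_ge0.
split; apply: rnorm_eq => eps eps0;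
  have [y [y1 y2] xy] := near _ (divr_gt0 eps0 u0);
  rewrite ltr_pdivlMr // in xy; apply: le_lt_trans xy.
- have -> : amul u x - x = amul u (x - y) - (x - y).
    by rewrite amulDr amulNr y1 opprB addrA subrK.
  have := rnormB (amul u (x - y)) (x - y); have := rnorm_amul u (x - y); nra.
- have -> : amul x u - x = amul (x - y) u - (x - y).
    by rewrite amulDl amulNl y2 opprB addrA subrK.
  have := rnormB (amul (x - y) u) (x - y); have := rnorm_amul (x - y) u; nra.
Qed.

End CuntzKrieger.

(** * Real and imaginary parts *)

Section Selfadjoint.
Context {R : realType} {A : cstarAlgType R}.
Notation C := (Cx R).
Implicit Types a : A.

Definition quarter_turn (b : bool) : C := if b then 'i else 1.

Lemma quarter_turn_conj b : quarter_turn b * (quarter_turn b)^* = 1.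
Proof. by case: b; rewrite /= ?conjCi ?rmorph1 ?mulr1 // mulrN -expr2 sqrCi opprK. Qed.

(* 2k Re a for b = false, - 2k Im a for b = true *)
Definition real_part (k : R) (b : bool) a : A :=
  ofR k *: (quarter_turn b *: a + (quarter_turn b)^* *: star a).

Lemma star_real_part k b a : star (real_part k b a) = real_part k b a.
Proof. by rewrite starZ conj_ofR starD !starZ conjCK starK addrC. Qed.

Lemma real_part_sqr k b a : amul (real_part k b a) (real_part k b a) =
  ofR (k ^+ 2) *: (quarter_turn b ^+ 2 *: amul a a +
    (quarter_turn b)^* ^+ 2 *: amul (star a) (star a) +
    (amul a (star a) + amul (star a) a)).
Proof.
rewrite amulZl amulZr scalerA -ofRM -expr2; congr (_ *: _).
rewrite !amulDl !amulDr !amulZl !amulZr !scalerA -!expr2.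
rewrite ![(quarter_turn b)^* * quarter_turn b]mulrC quarter_turn_conj !scale1r.
by rewrite [_ + _ *: amul (star a) (star a)]addrC addrACA.
Qed.

(** The terms in a^2 and its adjoint carry the squares of 1 and of i or -i, so they cancel in the
    sum. *)
Lemma real_part_sqr_sum k a :
  amul (real_part k true a) (real_part k true a) +
  amul (real_part k false a) (real_part k false a) =
  ofR (2 * k ^+ 2) *: (amul a (star a) + amul (star a) a).
Proof.
rewrite !real_part_sqr -scalerDr /= conjCi rmorph1 sqrrN !sqrCi !expr1n.
rewrite !scaleN1r !scale1r addrACA -opprD addNr add0r.
rewrite -[X in X + X]scale1r -scalerDl scalerA -ofR1 -ofRD -ofRM mulrC.
by congr (ofR _ *: _); ring.
Qed.

Lemma real_part_norm k b a : rnorm a <= 1 -> 0 <= k -> 2 * k <= 1 ->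
  rnorm (real_part k b a) <= 1.
Proof.
move=> a1 k0 k1; rewrite rnormZ rnorm_ofR ger0_norm //.
have q1 c : rnorm (quarter_turn c) = 1.
  have := congr1 (@rnorm R C) (quarter_turn_conj c).
  rewrite rnormCM rnorm_conj -expr2 -ofR1 rnorm_ofR normr1 => /eqP.
  by rewrite sqrp_eq1 ?rnorm_ge0 // => /eqP.
have := rnormD (quarter_turn b *: a) ((quarter_turn b)^* *: star a).
rewrite !rnormZ rnorm_conj q1 rnorm_star !mul1r.
move: (rnorm _) (rnorm a) a1 => x y; nra.
Qed.

(** When a^2 = 0 the square of the real part is k^2 (a a^* + a^* a), so the C*-identity asks only
    for 2 k^2 <= 1, where the triangle inequality in [real_part_norm] asks for 2 k <= 1. *)
Lemma real_part_norm_sqr0 k b a : rnorm a <= 1 -> amul a a = 0 -> 2 * k ^+ 2 <= 1 ->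
  rnorm (real_part k b a) <= 1.
Proof.
move=> a1 aa k1; rewrite -(@ler_pXn2r _ 2) ?nnegrE ?rnorm_ge0 //.
rewrite -rnorm_amul_self ?star_real_part // expr1n real_part_sqr.
rewrite -starM aa star0 !scaler0 !add0r rnormZ rnorm_ofR ger0_norm ?sqr_ge0 //.
have := rnormD (amul a (star a)) (amul (star a) a).
have := rnorm_amul a (star a); have := rnorm_amul (star a) a.
rewrite rnorm_star; have := rnorm_ge0 a; have := sqr_ge0 k.
move: (k ^+ 2) k1 (rnorm (_ + _)) (rnorm (amul _ _)) (rnorm (amul _ _)) (rnorm a) a1.
move=> K K1 x y z t t1 K0 t0 yt zt xyz.
have tt : t * t <= 1 by nra.
have : x <= 2 by lra.
nra.
Qed.

End Selfadjoint.

(** * Covers from families of odd selfadjoint contractions *)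

Section Cover.
Context {R : realType} {A : cstarAlgType R} {alpha : Z2 -> A -> A}.
Hypothesis act : is_action alpha.

(** The zero algebra is treated apart because [unital] requires a nonzero identity; there the zero
    maps form a cover. *)
Lemma LT_cover_zero n : is_one (0 : A) -> LT_cover alpha n.
Proof.
move=> one0; have triv (y z : A) : y = z.
  by have [<- _] := one0 y; have [<- _] := one0 z; rewrite !amul0l.
exists (fun _ _ => 0); split => [i|i f g|y]; last by split; exact: triv.
  by split=> [c y z|y z|y]; exact: triv.
exact: triv.
Qed.

Lemma LT_cover_of_selfadjoint (I : finType) (x : I -> A) n : #|I| = n.+1 ->
  (forall i, star (x i) = x i) -> (forall i, rnorm (x i) <= 1) ->
  (forall i, alpha true (x i) = - x i) ->
  is_one (\sum_i amul (x i) (x i)) -> LT_cover alpha n.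
Proof.
move=> In xs x1 xodd one; set e := \sum_i _ in one.
have [e0|e0] := eqVneq e 0; first by apply: LT_cover_zero; rewrite -e0.
have act' : @is_action R Z2 (unital one e0) alpha.
  by case: act => hom act1 actM actC; exact: IsAction.
have [rho rhoP] := choice (fun i =>
  @cone_hom R A e one e0 alpha (x i) act' (xs i) (x1 i) (xodd i)).
exists (fun j => rho (enum_val (cast_ord (esym In) j))).
split=> [j|j|]; try by case: (rhoP (enum_val (cast_ord (esym In) j))).
rewrite (_ : \sum_j _ = e) // /e (reindex (fun j => enum_val (cast_ord (esym In) j))).
  by apply: eq_bigr => j _; case: (rhoP (enum_val (cast_ord (esym In) j))).
exists (fun i => cast_ord In (enum_rank i)) => i _.
  by rewrite enum_valK cast_ordKV.
by rewrite cast_ordK enum_rankK.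
Qed.

Lemma dimLT_le n : LT_cover alpha n -> (dimLT alpha <= n%:R%:E)%E.
Proof. by move=> cov; apply: ereal_inf_lbound; exists n. Qed.

End Cover.

(** * The hypothesis on the adjacency matrix and the dimension bound *)

(** In the coordinate of w, the matrix entries count edges into w by their source, so the
    combination of rows becomes a sum over these edges. *)
Lemma adjacency_comb (R : realType) (E : digraph) (c : 'I_#|vert E| -> R) :
  const_mx 1 = \sum_i c i *: row i (1%:M + adjacency R E) ->
  forall w, c (enum_rank w) + \sum_(e | rng e == w) c (enum_rank (src e)) = 1.
Proof.
move=> comb w; have := congr1 (fun M : 'rV_#|vert E| => M ord0 (enum_rank w)) comb.
have count i : adjacency R E i (enum_rank w) =
    \sum_(e | rng e == w) (src e == enum_val i)%:R.
  rewrite mxE enum_rankK.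
  rewrite -(sum1_card [pred e : edge E | (src e == enum_val i) && (rng e == w)]).
  rewrite natr_sum [LHS]big_mkcond [RHS]big_mkcond; apply: eq_bigr => e _.
  by rewrite inE andbC; case: (rng e == w); case: (src e == _).
rewrite mxE summxE => ->.
under [RHS]eq_bigr => i _ do rewrite mxE mxE mxE count mxE mulrDr mulr_sumr.
rewrite big_split /=; congr (_ + _).
  rewrite (bigD1 (enum_rank w)) //= eqxx mulr1 big1 ?addr0 // => i /negbTE ->.
  by rewrite mulr0.
rewrite exchange_big; apply: eq_bigr => e _ /=.
rewrite (bigD1 (enum_rank (src e))) //= enum_rankK eqxx mulr1.
rewrite big1 ?addr0 // => i ie; case: eqP => [es|]; last by rewrite mulr0.
by move: ie; rewrite es enum_valK eqxx.
Qed.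

Unset Implicit Arguments.

Theorem theorem3p4 (R : realType) (E : digraph)
  (no_sinks : forall v : vert E, ~ is_sink v)
  (no_multiple : forall e f : edge E,
     src e = src f -> rng e = rng f -> e = f)
  (A : cstarAlgType R) (P : vert E -> A) (S : edge E -> A)
  (A_graph : is_graph_cstar P S)
  (alpha : Z2 -> A -> A) (alpha_gauge : is_Z2_gauge P S alpha)
  (comb : exists c : 'I_#|vert E| -> R, (forall i, 0 <= c i) /\
     const_mx 1 = \sum_i c i *: row i (1%:M + adjacency R E)) :
  (dimLT alpha <= (2 * #|vert E| - 1)%N%:R%:E)%E.
Proof.
have [act _ gaugeS] := alpha_gauge.
have [CK gen _] := A_graph.
have [c' [c'0 /adjacency_comb c'1]] := comb.
pose c v := c' (enum_rank v); have c0 v : 0 <= c v by exact: c'0.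
have c1 w : c w + \sum_(e | rng e == w) c (src e) = 1 by exact: c'1.
(* The factor k = sqrt(c_v / 2) makes 2 k^2 = c_v, so the two squares at v add up to c_v (a_v a_v^*
   + a_v^* a_v). *)
pose x (i : vert E * bool) := real_part (Num.sqrt (c i.1 / 2)) i.2 (out_sum (S := S) i.1).
have kE v : 2 * Num.sqrt (c v / 2) ^+ 2 = c v.
  by rewrite sqr_sqrtr ?divr_ge0 // mulrC divfK.
have one : is_one (\sum_i amul (x i) (x i)).
  rewrite (_ : \sum_i _ = \sum_v P v); first exact: sum_proj_is_one gen.
  transitivity (\sum_v ofR (c v) *: (P v + \sum_(e | src e == v) P (rng e))).
    rewrite -(pair_bigA _ (fun v b => amul (x (v, b)) (x (v, b)))) /=.
    apply: eq_bigr => v _; rewrite big_bool /x /= real_part_sqr_sum kE.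
    by rewrite (out_sum_mul_star CK) // (out_sum_star_mul CK).
  (* Regrouping by the range of the edges, P_w receives exactly the coefficient that [c1] evaluates
     to 1. *)
  transitivity (\sum_w ofR (c w + \sum_(e | rng e == w) c (src e)) *: P w); last first.
    by apply: eq_bigr => w _; rewrite c1 ofR1 scale1r.
  under eq_bigr do rewrite scalerDr.
  under [RHS]eq_bigr do rewrite ofRD scalerDl.
  rewrite !big_split; congr (_ + _) => /=.
  transitivity (\sum_e ofR (c (src e)) *: P (rng e)).
    under eq_bigr => v _ do rewrite scaler_sumr big_mkcond.
    rewrite exchange_big; apply: eq_bigr => e _ /=.
    rewrite (bigD1 (src e)) //= eqxx big1 ?addr0 // => v.
    by rewrite eq_sym => /negbTE ->.
  under [RHS]eq_bigr => w _.
    rewrite (big_morph (@ofR R) (@ofRD R) (erefl : ofR 0 = 0)) scaler_suml big_mkcond.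
    over.
  rewrite [RHS]exchange_big; apply: eq_bigr => e _ /=.
  rewrite (bigD1 (rng e)) //= eqxx big1 ?addr0 // => w.
  by rewrite eq_sym => /negbTE ->.
(* Without vertices the truncated subtraction gives 0, and the identity is an empty sum, so A =
   0. *)
apply: dimLT_le; case: (posnP #|vert E|) => [m0|m0].
  apply: LT_cover_zero; rewrite big_pred0 // in one.
  by case=> v _; have := card0_eq m0 v; rewrite inE.
apply: (LT_cover_of_selfadjoint act (x := x)) => //.
- by rewrite card_prod card_bool mulnC subn1 prednK // muln_gt0.
- by move=> i; exact: star_real_part.
- case=> v b; rewrite /x /=.
  have a1 : rnorm (out_sum (S := S) v) <= 1.
    rewrite -rnorm_star -(@ler_pXn2r _ 2) ?nnegrE ?rnorm_ge0 // expr1n.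
    rewrite -rnorm_star_amul starK (out_sum_mul_star CK) //.
    exact: CK_proj_norm CK v.
  have cv1 : c v <= 1 by rewrite -(c1 v) lerDl sumr_ge0.
  (* A loop at v makes c_v occur twice in [c1 v], so c_v <= 1/2 and 2 k <= 1. Without a loop a_v^2 =
     0, and 2 k^2 = c_v <= 1 suffices. *)
  have [[e ev rv]|noloop] := pselect (exists2 e, src e = v & rng e = v).
    apply: real_part_norm => //.
    have c2 : c v + c v <= 1.
      rewrite -[leRHS](c1 v) lerD2l (bigD1 e) /= ?rv //.
      by rewrite ev lerDl sumr_ge0.
    have := kE v; have := sqrtr_ge0 (c v / 2).
    move: (Num.sqrt _) => k; nra.
  apply: real_part_norm_sqr0 => //; last by rewrite kE.
  apply: (out_sum_sqr CK) => e ev rv; apply: noloop; by exists e.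
case=> v b; rewrite /x /=.
have [lin _ st] := action_hom act true.
have alphaZ a y : alpha true (a *: y) = a *: alpha true y.
  have alpha0 : alpha true 0 = 0.
    by have := lin (-1) 0 0; rewrite scaler0 addr0 scaleN1r addNr.
  by have := lin a y 0; rewrite alpha0 !addr0.
have alphaD y z : alpha true (y + z) = alpha true y + alpha true z.
  by have := lin 1 y z; rewrite !scale1r.
have alpha_out : alpha true (out_sum (S := S) v) = - out_sum (S := S) v.
  have alpha0 : alpha true 0 = 0 by have := alphaZ 0 0; rewrite !scale0r.
  rewrite /out_sum (big_morph _ alphaD alpha0) -sumrN.
  by apply: eq_bigr => e _; rewrite gaugeS expr1 scaleN1r.
by rewrite /real_part alphaZ alphaD !alphaZ st alpha_out starN !scalerN -opprD scalerN.
Qed.
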